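(* Let $D,r,Q$ be positive integers and $\epsilon>0$. There exists a positive integer $q=q(D,r,Q,\epsilon)$ such that the following holds for every $\delta\in(0,1]$. Let $P:\mathbb{Z}\to\mathbb{Z}^r$, $P(n)=(P_1(n),\dots,P_r(n))$ with $P_i\in\mathbb{Z}[n]$, $\deg P_i\le D$, have multiplicative complexity $Q$ and hyperplane-fleeing image. Let $T:\mathbb{Z}^r\curvearrowright(X,\mu)$ be an ergodic measure preserving action and $B\subset X$ be $(q,\delta)$-equidistributed. Then there exist arbitrarily large $n\in\mathbb{Z}$ with $$\mu(T^{P(n)}B\cap B)>\mu(B)^2-\epsilon-\sqrt{3\delta}.$$
   Context: A polynomial map $P$ has multiplicative complexity $Q$ if for all $\vec a\in\mathbb{Z}^r$, $q\in\mathbb{Z}$ with $\gcd(a_1,\dots,a_r,q)=1$, writing $(P(n)-P(0))\cdot\vec a=\sum_{j\ge1}b_jn^j$, one has $\gcd(b_1,\dots,b_D,q)\le Q$. A subset of $\mathbb{R}^r$ is hyperplane-fleeing if it is not contained in any proper affine subspace. With $F_n=[1,n]^r\cap\mathbb{Z}^r$, $B$ is $(q,\delta)$-equidistributed if for $\mu$-a.e. $x$, $\lim_{n\to\infty}\frac{1}{|F_n|}|\{a\in F_n:T^{qa}x\in B\}|\le(1+\delta)\mu(B)$. *)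

(* Defs.v *)
From HB Require Import structures.
From mathcomp Require Import all_boot all_order all_algebra.
From mathcomp Require Import all_classical all_reals all_analysis.
Set Implicit Arguments. Unset Strict Implicit. Unset Printing Implicit Defensive.
Import Order.TTheory GRing.Theory Num.Theory numFieldNormedType.Exports.
Local Open Scope ring_scope.
Local Open Scope classical_set_scope.

Definition polymap (r : nat) := 'I_r -> {poly int}.

Definition deg_le (r D : nat) (P : polymap r) := forall i, (size (P i) <= D.+1)%N.

Definition gcd_list (s : seq int) (q : int) : int := foldr gcdz q s.

(* Multiplicative complexity Q (with degree bound D):
   for all a in Z^r and q in Z with gcd(a_1,..,a_r,q)=1, writing
   (P(n)-P(0)).a = sum_{j>=1} b_j n^j, one has gcd(b_1,..,b_D,q) <= Q.
   Here b_j = sum_i a_i * (coefficient j of P_i), for j >= 1. *)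
Definition mult_complexity (r D Q : nat) (P : polymap r) :=
  forall (a : 'I_r -> int) (q : int),
    gcd_list [seq a i | i <- enum 'I_r] q = 1 ->
    gcd_list [seq \sum_(i < r) a i * (P i)`_j | j <- iota 1 D] q <= Q%:Z.

Definition polymap_eval (R : realType) (r : nat) (P : polymap r) (n : int)
  : 'rV[R]_r := \row_i ((P i).[n])%:~R.

(* The image of P is not contained in any proper affine subspace v + rowspace(W)
   of R^r (proper <-> rank W < r). *)
Definition hyperplane_fleeing (R : realType) (r : nat) (P : polymap r) :=
  ~ exists (v : 'rV[R]_r) (W : 'M[R]_r),
      (\rank W < r)%N /\
      forall n : int, (polymap_eval R P n - v <= W)%MS.

Definition mp_action (R : realType) (d : measure_display) (X : measurableType d)
  (mu : probability X R) (r : nat) (T : 'rV[int]_r -> X -> X) :=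
  (forall x, T 0 x = x) /\
  (forall u v x, T (u + v) x = T u (T v x)) /\
  (forall u, measurable_fun setT (T u)) /\
  (forall u A, measurable A -> mu (T u @^-1` A) = mu A).

Definition ergodic_action (R : realType) (d : measure_display) (X : measurableType d)
  (mu : probability X R) (r : nat) (T : 'rV[int]_r -> X -> X) :=
  forall A, measurable A -> (forall u, T u @^-1` A = A) ->
    mu A = 0%E \/ mu A = 1%E.

(* Ergodic average over F_n = [1,n]^r of visits of T^{q a} x to B:
   (1/|F_n|) |{a in F_n : T^{qa} x in B}|, with |F_n| = n^r. *)
Definition visit_avg (R : realType) (X : Type) (r : nat)
  (T : 'rV[int]_r -> X -> X) (q : nat) (B : set X) (x : X) (n : nat) : R :=
  (\sum_(a : {ffun 'I_r -> 'I_n})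
      \1_B (T (\row_i ((q%:Z) * ((a i)%:Z + 1))) x)) / (n%:R ^+ r).

Definition equidistributed (R : realType) (d : measure_display) (X : measurableType d)
  (mu : probability X R) (r : nat) (T : 'rV[int]_r -> X -> X)
  (q : nat) (delta : R) (B : set X) :=
  {ae mu, forall x,
     cvgn (@visit_avg R X r T q B x) /\
     ((limn (@visit_avg R X r T q B x))%:E <= (1 + delta)%:E * mu B)%E}.

Definition polymap_evalZ (r : nat) (P : polymap r) (n : int) : 'rV[int]_r :=
  \row_i (P i).[n].

(* Main.v *)
(* Let f be the indicator of B, phi(v) = mu(B /\ T^-v B) its correlation sequence
   and G_m the visit averages; |sin x| measures the distance of an angle x to pi Z.

   If sum_j c_j cos(2 v_j.theta) >= 0 for all theta, then sum_j c_j phi(v_j) >= 0: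
   the associated Toeplitz form is nonnegative along every orbit, by Fourier
   analysis on (Z/L)^r with L large. It therefore suffices to find a probability
   weight w on large n such that W(theta) = sum_n w_n cos(2 P(n).theta) satisfies
   W (1 - D_m) >= -2e, where D_m is the Fejer kernel of q[1,m]^r; this yields
   sum_n w_n phi(P(n)) >= sum_n w_n <G_m o T^P(n), G_m> - 2e, and the right side is
   at least 2 mu(B)^2 - |G_m|_2^2 - 2e. Equidistribution and dominated convergence
   bound |G_m|_2^2 by (1 + delta) mu(B)^2 + e.

   The weight comes from Weyl's method made uniform in theta. Van der Corput
   steps with bounded shifts show that a large exponential sum over a long interval
   forces the top coefficient of the phase to be nearly rational with bounded
   denominator. Averaging over many widely separated scales, at least D of
   which must be large when W is, the coefficients are treated one by one, from
   the top. Since P has rank r and multiplicative complexity Q, a theta for which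
   all coefficients of P.theta are nearly 1/k-integral is close to a point of
   order dividing q = k Q!, and there D_m is nearly 1. *)
Require Import Defs.
From HB Require Import structures.
From mathcomp Require Import all_boot all_order all_algebra.
From mathcomp Require Import all_classical all_reals all_analysis.
From mathcomp Require Import measurable_realfun.
From mathcomp Require Import ring lra zify.
Import Order.TTheory GRing.Theory Num.Theory numFieldNormedType.Exports.
Set Implicit Arguments. Unset Strict Implicit. Unset Printing Implicit Defensive.
Local Open Scope ring_scope.
Local Open Scope classical_set_scope.

(** * Exponential sums *)

Lemma normr_sinD (R : realType) (x y : R) :
  `|sin (x + y)| <= `|sin x| + `|sin y|.
Proof.
rewrite sinD; apply: le_trans (ler_normD _ _) _; rewrite !normrM.
by rewrite lerD // ?ler_piMr ?ler_piMl ?cos_max.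
Qed.

Lemma normr_sin_mulrn (R : realType) (x : R) n : `|sin (x *+ n)| <= `|sin x| *+ n.
Proof.
elim: n => [|n IHn]; first by rewrite !mulr0n sin0 normr0.
by rewrite !mulrS; apply: le_trans (normr_sinD _ _) _; rewrite lerD2l.
Qed.

Lemma normr_sinM_nat (R : realType) (x : R) n : `|sin (n%:R * x)| <= n%:R * `|sin x|.
Proof. by rewrite !mulr_natl; exact: normr_sin_mulrn. Qed.

Lemma normr_sinM_int (R : realType) (x : R) (k : int) :
  `|sin (k%:~R * x)| <= `|k|%:~R * `|sin x|.
Proof.
case: k => k; first exact: normr_sinM_nat.
rewrite NegzE mulrNz mulNr sinN !normrN.
exact: normr_sinM_nat.
Qed.

Lemma normr_sin_sum (R : realType) (I : Type) (s : seq I) (P : pred I) (F : I -> R) :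
  `|sin (\sum_(i <- s | P i) F i)| <= \sum_(i <- s | P i) `|sin (F i)|.
Proof.
elim/big_ind2: _ => //; first by rewrite sin0 normr0.
by move=> x1 x2 y1 y2 h1 h2; apply: le_trans (normr_sinD _ _) (lerD _ _).
Qed.

Lemma dvdn_normr_sin (R : realType) (x : R) (m n : nat) : (m %| n)%N -> (0 < n)%N ->
  `|sin (n%:R * x)| <= n%:R * `|sin (m%:R * x)|.
Proof.
move=> /dvdnP[k ->] kn; rewrite {1}natrM -mulrA.
apply: le_trans (normr_sinM_nat _ _) _; apply: ler_wpM2r => //.
by rewrite ler_nat leq_pmulr //; case: m kn => //; rewrite muln0.
Qed.

Lemma cos_double (R : realType) (x : R) : cos (2 * x) = 1 - 2 * sin x ^+ 2.
Proof. by rewrite mulr_natl cos_mulr2n cos2sin2 -mulr_natl; ring. Qed.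

(** Cosines are taken at doubled angles throughout: they then have period pi, the same as [|sin|],
    which controls their variation. *)
Lemma dist_cos_double (R : realType) (x y : R) :
  `|cos (2 * (x + y)) - cos (2 * x)| <= 2 * `|sin y|.
Proof.
have -> : cos (2 * (x + y)) - cos (2 * x) = - 2 * (sin (2 * x + y) * sin y).
  have -> : 2 * (x + y) = (2 * x + y) + y by ring.
  have -> : cos (2 * x) = cos ((2 * x + y) - y) by congr cos; ring.
  by rewrite cosD cosB; ring.
rewrite !normrM normrN [`|2|]ger0_norm // ler_wpM2l // ler_piMl //.
exact: sin_max.
Qed.

Lemma sqr_sum_cos_sin (R : realType) (n : nat) (x : 'I_n -> R) :
  (\sum_i cos (x i)) ^+ 2 + (\sum_i sin (x i)) ^+ 2
  = \sum_i \sum_j cos (x i - x j).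
Proof.
rewrite !expr2 !mulr_suml -big_split /=; apply: eq_bigr => i _.
by rewrite !mulr_sumr -big_split; apply: eq_bigr => j _; rewrite cosB.
Qed.

Lemma sumr_const_ord (R : realType) (n : nat) (x : R) : \sum_(i < n) x = n%:R * x.
Proof. by rewrite sumr_const card_ord mulr_natl. Qed.

(** Cauchy-Schwarz against the constant 1, from the nonnegativity of the variance of [y]. *)
Lemma sqr_sum_le (R : realType) (K : nat) (y : 'I_K -> R) :
  (\sum_i y i) ^+ 2 <= K%:R * \sum_i y i ^+ 2.
Proof.
case: K y => [|K] y; first by rewrite !big_ord0 expr0n mul0r.
set S := \sum_i y i; set q := \sum_i y i ^+ 2.
have : 0 <= \sum_i (K.+1%:R * y i - S) ^+ 2 by apply: sumr_ge0 => i _; exact: sqr_ge0.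
have -> : \sum_i (K.+1%:R * y i - S) ^+ 2 = K.+1%:R * (K.+1%:R * q - S ^+ 2).
  under eq_bigr => i _.
    have -> : (K.+1%:R * y i - S) ^+ 2 =
      K.+1%:R ^+ 2 * y i ^+ 2 + (- 2 * K.+1%:R * S) * y i + S ^+ 2 by ring.
    over.
  rewrite !big_split /= -!mulr_sumr sumr_const_ord -/S -/q; ring.
by rewrite pmulr_rge0 ?ltr0n // subr_ge0.
Qed.

Lemma dist_sum_shift (R : realType) (g : nat -> R) (K h : nat) :
  (forall n, `|g n| <= 1) ->
  `|\sum_(n < K) g (n + h)%N - \sum_(n < K) g n| <= 2 * h%:R.
Proof.
move=> g1; elim: h => [|h IHh].
  by under eq_bigr do rewrite addn0; rewrite subrr normr0 mulr0.
have E : \sum_(n < K) g (n + h.+1)%N = \sum_(n < K) g (n + h)%N + (g (K + h)%N - g h).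
  have : \sum_(n < K.+1) g (n + h)%N = \sum_(n < K.+1) g (n + h)%N by [].
  rewrite {1}big_ord_recl big_ord_recr /= add0n => E.
  rewrite addrA -E addrAC subrr add0r; apply: eq_bigr => i _.
  by rewrite addnS -addSn.
rewrite E -(natr1 h) mulrDr mulr1 addrAC; apply: le_trans (ler_normD _ _) _.
apply: lerD => //; apply: le_trans (ler_normB _ _) _.
by have := g1 (K + h)%N; have := g1 h; lra.
Qed.

(* [c] is the common value of the normalised [d]-th differences of [f]; the
   definition is stable under differencing, which is all van der Corput needs. *)
Fixpoint top_diff (R : realType) (d : nat) (f : nat -> R) (c : R) : Prop :=
  if d is e.+1 then
    forall h : nat, top_diff e (fun n => f (n + h)%N - f n) (h%:R * c)
  else forall n, f n = c.

Lemma top_diff_shift (R : realType) d (f : nat -> R) c s :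
  top_diff d f c -> top_diff d (fun n => f (n + s)%N) c.
Proof.
elim: d f c => [|d IHd] f c /=; first by move=> + n; apply.
move=> fc h; have := IHd _ _ (fc h).
by congr top_diff; apply/funext => n /=; rewrite addnAC.
Qed.

(** Averaging the sum over [H] shifts costs little because [K] is much larger than [H].
    Cauchy-Schwarz in [n] then leaves a diagonal of relative size 1 / H, negligible by the choice of
    [H], so some differenced sum must be large. The base shift [h] may stay, since [top_diff] is
    invariant under shifts. *)
Lemma van_der_corput (R : realType) (eps : R) (H K : nat) (f : nat -> R) :
  0 < eps -> 16 / eps ^+ 2 <= H%:R -> 4 * H%:R / eps <= K%:R -> (0 < K)%N ->
  eps * K%:R <= `|\sum_(n < K) cos (2 * f n)| ->
  exists h t : nat, [/\ (0 < t <= H)%N &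
   eps ^+ 2 / 16 * K%:R <= `|\sum_(n < K) cos (2 * (f (n + h + t)%N - f (n + h)%N))|].
Proof.
move=> e0 HH HK K0 large; apply: contrapT => /forallNP small.
have e2 : 0 < eps ^+ 2 by rewrite exprn_gt0.
have Hgt0 : 0 < H%:R :> R by apply: lt_le_trans HH; rewrite divr_gt0.
have Kgt0 : 0 < K%:R :> R by rewrite ltr0n.
pose e' := eps ^+ 2 / 16.
have {}small h h' : (h < H)%N -> (h' < H)%N -> h != h' ->
    `|\sum_(n < K) cos (2 * f (n + h)%N - 2 * f (n + h')%N)| <= e' * K%:R.
  wlog hh' : h h' / (h < h')%N => [wl hH h'H ne|].
    have [lt|lt|eq] := ltngtP h h'; last by rewrite eq eqxx in ne.
      exact: wl.
    have := wl _ _ lt h'H hH; rewrite eq_sym => /(_ ne).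
    by under eq_bigr do rewrite -opprB cosN.
  move=> hH h'H _; rewrite leNgt; apply/negP => /ltW big.
  have /forallNP/(_ (h' - h)%N) := small h; apply; split.
    by rewrite subn_gt0 hh' (leq_trans (leq_subr _ _) (ltnW h'H)).
  move: big; congr (_ <= `|_|); apply: eq_bigr => n _.
  by rewrite -mulrBr -opprB mulrN cosN -addnA subnKC // ltnW.
pose y (n : 'I_K) := \sum_(h < H) cos (2 * f (n + h)%N).
have upper : (\sum_n y n) ^+ 2 <= K%:R * (K%:R * H%:R + H%:R ^+ 2 * (e' * K%:R)).
  apply: le_trans (sqr_sum_le y) _; apply: ler_wpM2l => //.
  have -> : K%:R * H%:R + H%:R ^+ 2 * (e' * K%:R)
      = \sum_(h < H) (K%:R + \sum_(h' < H) e' * K%:R) :> R.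
    by rewrite !sumr_const_ord; ring.
  (* Adding the square of the sine sum turns each [y n ^+ 2] into a squared modulus, whose expansion
     carries the differenced sums. *)
  have : \sum_n y n ^+ 2
    <= \sum_(n < K) \sum_(h < H) \sum_(h' < H) cos (2 * f (n + h)%N - 2 * f (n + h')%N).
    apply: ler_sum => n _.
    rewrite -(sqr_sum_cos_sin (fun h : 'I_H => 2 * f (n + h)%N)).
    by rewrite /y lerDl sqr_ge0.
  move=> /le_trans; apply; rewrite exchange_big /=; apply: ler_sum => h _.
  rewrite exchange_big /= [leLHS](bigD1 h) //=; apply: lerD.
    by under eq_bigr do rewrite subrr cos0; rewrite sumr_const_ord mulr1.
  apply: (@le_trans _ _ (\sum_(h' < H | h' != h) e' * K%:R)).
    apply: ler_sum => h' ne; apply: le_trans (ler_norm _) _.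
    by apply: small => //; rewrite eq_sym.
  rewrite [leRHS](bigD1 h) //= lerDr; rewrite mulr_ge0 // /e' ?divr_ge0 ?ltW //.
(* A shift by less than [H] moves the sum by at most 2 H, which is at most half of [eps * K]. *)
have lower : H%:R * (eps * K%:R / 2) <= `|\sum_n y n|.
  have -> : \sum_n y n = \sum_(h < H) \sum_(n < K) cos (2 * f (n + h)%N).
    by rewrite /y exchange_big.
  pose S := \sum_(n < K) cos (2 * f n).
  have dist : `|\sum_(h < H) \sum_(n < K) cos (2 * f (n + h)%N) - \sum_(h < H) S|
      <= \sum_(h < H) 2 * H%:R.
    rewrite -sumrB; apply: le_trans (ler_norm_sum _ _ _) _; apply: ler_sum => h _.
    apply: le_trans (dist_sum_shift (g := fun n => cos (2 * f n)) _ _ _) _.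
      by move=> n; exact: cos_max.
    by rewrite ler_wpM2l // ler_nat ltnW.
  move: dist; rewrite !sumr_const_ord => dist.
  have key : H%:R * `|S| <= `|\sum_(h < H) \sum_(n < K) cos (2 * f (n + h)%N)| + H%:R * (2 * H%:R).
    rewrite -[X in X * _]ger0_norm // -normrM -lerBlDl.
    by apply: le_trans (lerB_dist _ _) _; rewrite distrC.
  have HK' : 4 * H%:R <= eps * K%:R by rewrite [leRHS]mulrC -ler_pdivrMr.
  apply: (@le_trans _ _ (H%:R * `|S| - H%:R * (2 * H%:R))); last by rewrite lerBlDr.
  by rewrite -mulrBr ler_wpM2l //; have := large; rewrite -/S; lra.
have : (H%:R * (eps * K%:R / 2)) ^+ 2 <= (\sum_n y n) ^+ 2.
  rewrite -[leRHS]real_normK ?num_real // ler_sqr ?nnegrE //.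
  by rewrite !mulr_ge0 // ltW.
move=> /le_trans /(_ upper).
have -> : (H%:R * (eps * K%:R / 2)) ^+ 2 = (K%:R ^+ 2 * H%:R) * (H%:R * eps ^+ 2 / 4) :> R by field.
have -> : K%:R * (K%:R * H%:R + H%:R ^+ 2 * (e' * K%:R))
  = (K%:R ^+ 2 * H%:R) * (1 + H%:R * eps ^+ 2 / 16) :> R by rewrite /e'; ring.
rewrite ler_pM2l ?mulr_gt0 ?exprn_gt0 //.
by move: HH; rewrite ler_pdivrMr //; lra.
Qed.

(** Differencing lowers the degree and multiplies [c] by a bounded integer, down to a geometric sum.
    The quantifiers matter: [B] depends on [D] and [eps] alone, and the precision [eta] affects only
    the length [K0]. *)
Lemma top_diff_large_cos_sum (R : realType) (D : nat) (eps : R) : 0 < eps ->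
  exists2 B : nat, (0 < B)%N & forall eta : R, 0 < eta ->
  exists2 K0 : nat, (0 < K0)%N & forall (K d : nat) (f : nat -> R) (c : R),
    (K0 <= K)%N -> (0 < d <= D)%N -> top_diff d f c ->
    eps * K%:R <= `|\sum_(n < K) cos (2 * f n)| -> `|sin (B%:R * c)| <= eta.
Proof.
elim: D eps => [|D IHD] eps e0.
  by exists 1%N => // eta _; exists 1%N => // K [|d].
case: D IHD => [|D] IHD.
  exists 1%N => // eta eta0.
  exists (Num.truncn (1 / (eps * eta))).+1 => // K [|[|d]] // f c K0 _ /= fc large.
  have {}fc n : f n = f 0%N + n%:R * c.
    by have := fc n 0%N; rewrite add0n => <-; rewrite addrC subrK.
  have K1 : 0 < K%:R :> R by rewrite ltr0n (leq_trans _ K0).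
  (* Multiplying by 2 sin c telescopes the geometric sum; with the lower bound on the sum, |sin c|
     is at most 1 / (eps K). *)
  have tele : 2 * sin c * \sum_(n < K) cos (2 * f n)
      = sin (2 * f 0%N + (2 * K%:R - 1) * c) - sin (2 * f 0%N - c).
    elim: (K) => [|m IHm].
      by rewrite big_ord0 mulr0 mulr0 sub0r mulN1r subrr.
    rewrite big_ord_recr /= mulrDr IHm (fc m) -(natr1 m).
    set x := 2 * (f 0%N + m%:R * c).
    have -> : 2 * f 0%N + (2 * m%:R - 1) * c = x - c by rewrite /x; ring.
    have -> : 2 * f 0%N + (2 * (m%:R + 1) - 1) * c = x + c by rewrite /x; ring.
    by rewrite (sinB x c) (sinD x c); ring.
  rewrite mul1r.
  have : 2 * `|sin c| * (eps * K%:R) <= 2.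
    apply: (@le_trans _ _ (2 * `|sin c| * `|\sum_(n < K) cos (2 * f n)|)).
      by rewrite ler_wpM2l // mulr_ge0.
    rewrite -[X in X * _ * _](@ger0_norm _ 2) // -!normrM tele.
    apply: le_trans (ler_normB _ _) _.
    by have := sin_max (2 * f 0%N + (2 * K%:R - 1) * c); have := sin_max (2 * f 0%N - c); lra.
  move=> sc.
  have : 1 / (eps * eta) < K%:R.
    by apply: lt_le_trans (truncnS_gt _) _; rewrite ler_nat.
  rewrite ltr_pdivrMr ?mulr_gt0 // => Klarge.
  rewrite -(ler_pM2r (mulr_gt0 e0 K1)).
  by move: Klarge sc; lra.
(* One threshold for both uses of the induction hypothesis: [eps] for phases of smaller degree,
   [eps ^+ 2 / 16] for the sum produced by van der Corput. *)
have [e1 e1gt0 [e1le e1le2]] : exists2 e1 : R, 0 < e1 & e1 <= eps /\ e1 <= eps ^+ 2 / 16.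
  exists (Num.min eps (eps ^+ 2 / 16)); last by rewrite !ge_min !lexx orbT.
  by rewrite lt_min e0 divr_gt0 // exprn_gt0.
have [B B0 HB] := IHD _ e1gt0.
pose H := (Num.truncn (16 / eps ^+ 2)).+1.
have Hf : (0 < H`!)%N by exact: fact_gt0.
(* The factorial of [H] is a multiple of every shift t <= H, so one denominator serves them all. *)
exists (B * H`!)%N; first by rewrite muln_gt0 B0.
move=> eta eta0.
have [|K0 K00 HK] := HB (eta / (B * H`!)%:R).
  by rewrite divr_gt0 // ltr0n muln_gt0 B0.
exists (maxn K0 (Num.truncn (4 * H%:R / eps)).+1); first by rewrite leq_max K00.
have weaken (m : nat) (c : R) : (0 < m)%N -> (m %| B * H`!)%N ->
    `|sin (m%:R * c)| <= eta / (B * H`!)%:R -> `|sin ((B * H`!)%:R * c)| <= eta.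
  move=> m0 mB small.
  have BH : (0 < B * H`!)%N by rewrite muln_gt0 B0.
  apply: le_trans (dvdn_normr_sin _ mB BH) _.
  by move: small; rewrite ler_pdivlMr ?ltr0n // mulrC.
move=> K d f c; rewrite geq_max => /andP[KK0 KK1] /andP[d0].
have K0R : 0 <= K%:R :> R by [].
rewrite leq_eqVlt => /predU1P[->{d d0}|dD] fc large; last first.
  apply: (weaken B) => //; first exact: dvdn_mulr.
  apply: (HK K d f c) => //; first by rewrite d0.
  by apply: le_trans large; rewrite ler_wpM2r.
have [|||h [t [/andP[t0 tH] large']]] := van_der_corput e0 (H := H) (K := K) _ _ _ large.
- by rewrite ltW // truncnS_gt.
- by apply: ltW; apply: lt_le_trans (truncnS_gt _) _; rewrite ler_nat.
- exact: leq_trans KK0.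
apply: (weaken (B * t)%N); first by rewrite muln_gt0 B0.
  by rewrite dvdn_pmul2l //; apply: dvdn_fact; rewrite t0.
rewrite natrM -mulrA.
have td : top_diff D.+1 (fun n => f (n + h + t)%N - f (n + h)%N) (t%:R * c).
  exact: (@top_diff_shift _ D.+1 _ _ h (fc t)).
apply: (HK K D.+1 _ _ KK0 _ td); first by rewrite /= leqnn.
by apply: le_trans large'; rewrite ler_wpM2r.
Qed.

Lemma top_diff_affine_poly (R : realType) (d : nat) (p : {poly R}) (x M : R) :
  (size p <= d.+1)%N ->
  top_diff d (fun n => p.[x + M * n%:R]) (d`!%:R * M ^+ d * p`_d).
Proof.
elim: d p x => [|d IHd] p x sp /=.
  by move=> n; rewrite (size1_polyC sp) hornerC coefC eqxx fact0 expr0 !mul1r.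
move=> h; pose b := M * h%:R.
(* The Taylor expansion of p(y + b) - p(y); its term of order zero cancels, so the degree drops. *)
pose q := \sum_(i < d.+1) b ^+ i.+1 *: p^`N(i.+1).
have sq : (size q <= d.+1)%N.
  apply: (leq_trans (size_sum _ _ _)); apply/bigmax_leqP => i _.
  apply: leq_trans (size_scale_leq _ _) _.
  apply: leq_trans (leq_trans (size_poly _ _) _); first exact: leqnn.
  by rewrite leq_subLR (leq_trans sp) // addSn ltnS leq_addl.
have Eq n : p.[x + M * (n + h)%N%:R] - p.[x + M * n%:R] = q.[x + M * n%:R].
  have -> : x + M * (n + h)%N%:R = (x + M * n%:R) + b by rewrite natrD /b; ring.
  rewrite (nderiv_taylor_wide (n := d.+2)) //; last exact: mulrC.
  rewrite big_ord_recl /= nderivn0 expr0 mulr1 addrAC subrr add0r horner_sum.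
  by apply: eq_bigr => i _; rewrite hornerZ mulrC.
have -> : (fun n => p.[x + M * (n + h)%N%:R] - p.[x + M * n%:R])
    = (fun n => q.[x + M * n%:R]) by apply/funext.
have := IHd q x sq; congr top_diff.
(* Only the first derivative of [p] reaches degree [d]; its factor [d.+1] completes the
   factorial. *)
have -> : q`_d = b * (p`_d.+1 *+ d.+1).
  rewrite coef_sum big_ord_recl /= big1 ?addr0 => [|i _].
    by rewrite expr1 coefZ nderivn1 coef_deriv.
  rewrite coefZ [X in _ * X]nth_default ?mulr0 //.
  apply: leq_trans (size_poly _ _) _.
  by rewrite leq_subLR (leq_trans sp) // /bump /= !add1n !addSn !ltnS leq_addl.
rewrite factS natrM exprS -mulr_natr /b; ring.
Qed.

(** * Averages over separated scales *)

(** [mk] holds a step and a length. Starting at [N.+1] times the step puts all points beyond [N]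
    when the step is positive, and multiples of the step neutralise coefficients that are nearly
    rational with that denominator. *)
Definition ap_cos_avg (R : realType) (N : nat) (mk : nat * nat) (p : {poly R}) : R :=
  (\sum_(m < mk.2) cos (2 * p.[(mk.1 * (N.+1 + m))%N%:R])) / mk.2%:R.

(** At the point M n the term of degree i is the integer M^(i-1) n^i times M p_i, and the latter is
    close to a multiple of pi. *)
Lemma sin_tail_le (R : realType) (D d M n : nat) (p : {poly R}) (tau : R) :
  (size p <= D.+1)%N -> (0 < M)%N -> (0 < n)%N -> 0 <= tau ->
  (forall i, (d < i <= D)%N -> `|sin (M%:R * p`_i)| <= tau) ->
  `|sin (p.[(M * n)%:R] - (take_poly d.+1 p).[(M * n)%:R])|
  <= D.+1%:R * ((M * n) ^ D)%:R * tau.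
Proof.
move=> sp M0 n0 tau0 small; set x : R := (M * n)%:R.
have sp' : (size (take_poly d.+1 p) <= D.+1)%N.
  apply: leq_trans sp; rewrite /take_poly; apply/leq_sizeP => j pj.
  by rewrite coef_poly nth_default // if_same.
rewrite (horner_coef_wide _ sp) (horner_coef_wide _ sp') -sumrB.
apply: le_trans (normr_sin_sum _ _ _) _.
apply: (@le_trans _ _ (\sum_(i < D.+1) ((M * n) ^ D)%:R * tau)); last first.
  by rewrite sumr_const_ord mulrA.
apply: ler_sum => i _; rewrite coef_take_poly.
have [id|di] := leqP i d; first by rewrite ltnS id subrr sin0 normr0 mulr_ge0.
rewrite ltnS leqNgt di /= mul0r subr0.
have i0 : (0 < i)%N by exact: leq_trans di.
have iD : (i <= D)%N by rewrite -ltnS.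
have -> : p`_i * x ^+ i = (M ^ i.-1 * n ^ i)%:R * (M%:R * p`_i).
  have Mi : M%:R ^+ i = M%:R * M%:R ^+ i.-1 :> R by rewrite -exprS prednK.
  by rewrite /x !natrM exprMn Mi !natrX; ring.
apply: le_trans (normr_sinM_nat _ _) _; apply: ler_pM => //; last first.
  by apply: small; rewrite di.
rewrite ler_nat; apply: (@leq_trans ((M * n) ^ i)); last first.
  by rewrite leq_pexp2l // muln_gt0 M0.
by rewrite expnMn leq_mul2r leq_pexp2l ?orbT // leq_pred.
Qed.

(* The average added in the induction step is over the longest interval, with the
   smallest step: its length is chosen after the precision [tau'] required by the
   others, and [tau] after it. If it is large it settles the coefficient of
   degree [d]. *)
Lemma multiscale_cos_avg (R : realType) (D B N : nat) (eps : R) :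
  (0 < B)%N -> 0 < eps ->
  (forall eta : R, 0 < eta -> exists2 K0 : nat, (0 < K0)%N &
    forall (K d : nat) (f : nat -> R) (c : R),
    (K0 <= K)%N -> (0 < d <= D)%N -> top_diff d f c ->
    eps / 2 * K%:R <= `|\sum_(n < K) cos (2 * f n)| -> `|sin (B%:R * c)| <= eta) ->
  forall (J M : nat) (eta : R), (0 < M)%N -> 0 < eta ->
  exists2 tau : R, 0 < tau & exists mks : seq (nat * nat),
  [/\ size mks = J, all (fun mk => (0 < mk.1)%N && (0 < mk.2)%N) mks &
   forall (d : nat) (p : {poly R}), (d <= D)%N -> (size p <= D.+1)%N ->
   (forall i, (d < i <= D)%N -> `|sin (M%:R * p`_i)| <= tau) ->
   (d <= count (fun mk => (eps <= `|ap_cos_avg N mk p|)%R) mks)%N ->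
   forall i, (0 < i <= D)%N ->
     `|sin ((iter J (fun M => B * D`! * M ^ D) M)%N%:R * p`_i)| <= eta].
Proof.
move=> B0 e0 HB; elim=> [|J IHJ] M eta M0 eta0.
  exists eta => //; exists [::]; split=> // d p dD sp small.
  by rewrite leqn0 => /eqP d0; rewrite d0 in small.
(* A multiple of each factor B d! M^d with d <= D that the new average can produce and, when [D] is
   positive, of [M], so coefficients already settled remain so. *)
pose M' := (B * D`! * M ^ D)%N.
have M'0 : (0 < M')%N by rewrite !muln_gt0 B0 fact_gt0 expn_gt0 M0.
have M'R : 0 < M'%:R :> R by rewrite ltr0n.
have [tau' tau'0 [mks [szJ pos concl]]] := IHJ M' eta M'0 eta0.
pose tau1 := tau' / M'%:R.
have tau10 : 0 < tau1 by rewrite divr_gt0.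
have [K K0 HK] := HB tau1 tau10.
pose Z : R := D.+1%:R * ((M * (N.+1 + K)) ^ D)%:R.
have Z0 : 0 < Z by rewrite mulr_gt0 // ltr0n expn_gt0 muln_gt0 M0.
(* With the second entry, the tail of [p] changes each cosine by at most [eps / 2]; this leaves the
   [eps / 2] required by [HB]. *)
pose tau := Num.min tau1 (eps / 4 / Z).
exists tau; first by rewrite lt_min tau10 !divr_gt0.
have tau0 : 0 <= tau by rewrite le_min ltW // ltW // !divr_gt0.
exists ((M, K) :: mks); split => [|/=|d p dD sp small cnt i iD].
- by rewrite /= szJ.
- by rewrite M0 K0.
have lift (m : nat) j : (m %| M')%N -> `|sin (m%:R * p`_j)| <= tau1 ->
    `|sin (M'%:R * p`_j)| <= tau'.
  move=> mM' le1; apply: le_trans (dvdn_normr_sin _ mM' M'0) _.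
  by move: le1; rewrite /tau1 ler_pdivlMr // mulrC.
have small' j : (d < j <= D)%N -> `|sin (M'%:R * p`_j)| <= tau'.
  move=> /[dup] dj /andP[dj1 dj2]; apply: (lift M).
    by rewrite dvdn_mull // dvdn_exp // (leq_trans _ dj2) // (leq_trans _ dj1).
  by apply: le_trans (small _ dj) _; rewrite ge_min lexx.
rewrite iterSr; rewrite /= in cnt.
case: d => [|d] in dD small small' cnt *.
  exact: (concl 0%N).
(* If the new average is not large, the remaining ones already contain enough large averages. If it
   is, one fewer is needed, since it settles degree [d.+1]. *)
case: (boolP (eps <= _)) cnt => [bad|_] /=; last first.
  by rewrite add0n => cnt; exact: (concl d.+1).
rewrite add1n ltnS => cnt; apply: (concl d) => //; first exact: ltnW.
move=> j /andP[]; rewrite leq_eqVlt => /predU1P[<- _|dj jD]; last first.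
  by apply: small'; rewrite dj.
(* Truncation makes the coefficient of degree [d.+1] the leading one. *)
pose p' := take_poly d.+2 p.
have sp' : (size p' <= d.+2)%N by exact: size_take_poly.
have td := top_diff_affine_poly (M%:R * N.+1%:R) M%:R sp'.
have := HK K d.+1 _ _ (leqnn _) _ td; rewrite dD => /(_ isT) concl'.
have : `|sin (B%:R * (d.+1`!%:R * M%:R ^+ d.+1 * p'`_d.+1))| <= tau1.
  apply: concl'.
  have close : `|\sum_(n < K) cos (2 * p'.[M%:R * N.+1%:R + M%:R * n%:R])
      - \sum_(n < K) cos (2 * p.[(M * (N.+1 + n))%N%:R])| <= K%:R * (eps / 2).
    rewrite -sumrB -sumr_const_ord; apply: le_trans (ler_norm_sum _ _ _) _.
    apply: ler_sum => n _.
    rewrite -mulrDr -natrD -natrM distrC.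
    set x := (M * (N.+1 + n))%N.
    have -> : p.[x%:R] = p'.[x%:R] + (p.[x%:R] - p'.[x%:R]) by ring.
    apply: le_trans (dist_cos_double _ _) _.
    have : `|sin (p.[x%:R] - p'.[x%:R])| <= D.+1%:R * (x ^ D)%:R * tau.
      exact: sin_tail_le.
    have : D.+1%:R * (x ^ D)%:R * tau <= Z * (eps / 4 / Z).
      apply: ler_pM => //.
        rewrite ler_wpM2l // ler_nat leq_exp2r ?(leq_trans _ dD) //.
        by rewrite /x leq_mul2l leq_add2l ltnW ?orbT.
      by rewrite ge_min lexx orbT.
    rewrite mulrCA divff ?gt_eqF // mulr1; lra.
  move: bad; rewrite /ap_cos_avg /= normrM normfV [`|K%:R|]ger0_norm //.
  rewrite ler_pdivlMr ?ltr0n // => bad.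
  have := lerB_dist (\sum_(n < K) cos (2 * p.[(M * (N.+1 + n))%N%:R]))
     (\sum_(n < K) cos (2 * p'.[M%:R * N.+1%:R + M%:R * n%:R])).
  by rewrite distrC; move: bad close; lra.
rewrite coef_take_poly ltnSn -natrX -natrM mulrA -natrM.
apply: lift; rewrite /M' mulnA dvdn_mul ?dvdn_exp2l //.
by rewrite dvdn_pmul2l //; rewrite -(bin_fact dD) dvdn_mull // dvdn_mulr.
Qed.

(** Each scale has an average of modulus at most 1, so a mean of size [eps] over [J] scales forces
    at least J eps / 2 >= D averages above [eps / 2], one for each coefficient. [k] is fixed before
    [eta] and [N] because it determines the final [q]. *)
Lemma uniform_weyl (R : realType) (D : nat) (eps : R) : 0 < eps ->
  exists2 k : nat, (0 < k)%N & forall (eta : R) (N : nat), 0 < eta ->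
  exists ws : seq (R * nat),
  [/\ forall w, w \in ws -> 0 <= w.1 /\ (N < w.2)%N, \sum_(w <- ws) w.1 = 1 &
   forall p : {poly R}, (size p <= D.+1)%N ->
   eps <= `|\sum_(w <- ws) w.1 * cos (2 * p.[w.2%:R])| ->
   forall i, (0 < i <= D)%N -> `|sin (k%:R * p`_i)| <= eta].
Proof.
move=> e0.
have e2 : 0 < eps / 2 by rewrite divr_gt0.
have e4 : 0 < eps / 2 / 2 by rewrite divr_gt0.
have [B B0 HB] := top_diff_large_cos_sum D e4.
pose J := (Num.truncn (D%:R / (eps / 2))).+1.
pose k := iter J (fun M => B * D`! * M ^ D)%N 1%N.
exists k.
  rewrite /k /=; elim: (Num.truncn _) => [|j IHj] /=.
    by rewrite !muln_gt0 B0 fact_gt0 exp1n.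
  by rewrite muln_gt0 (muln_gt0 B) B0 fact_gt0 expn_gt0 IHj.
move=> eta N eta0.
have [tau tau0 [mks [szJ /allP pos concl]]] :=
  multiscale_cos_avg N B0 e2 HB J (ltn0Sn 0) eta0.
(* Each scale receives total weight 1 / J, spread evenly over its progression. *)
pose ws : seq (R * nat) := [seq ((J%:R * mk.2%:R)^-1, (mk.1 * (N.+1 + m))%N)
   | mk <- mks, m <- iota 0 mk.2].
have wsE (F : nat -> R) : \sum_(w <- ws) w.1 * F w.2 =
    J%:R^-1 * \sum_(mk <- mks) (\sum_(m < mk.2) F (mk.1 * (N.+1 + m))%N) / mk.2%:R.
  rewrite /ws big_allpairs_dep /= mulr_sumr; apply: eq_bigr => mk _.
  rewrite -/(index_iota 0 mk.2) -{1}(subn0 mk.2) big_mkord.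
  by rewrite -mulr_sumr invfM; ring.
have J0 : 0 < J%:R :> R by rewrite ltr0n.
exists ws; split.
- move=> w /allpairsPdep[mk [m [mkin _ ->]]] /=; split.
    by rewrite invr_ge0 mulr_ge0.
  have /andP[m1 _] := pos _ mkin.
  by rewrite (@leq_trans (N.+1 + m)) ?leq_addr // leq_pmull.
- have := wsE (fun=> 1); under eq_bigr do rewrite mulr1.
  move=> ->; rewrite (eq_big_seq (fun=> 1)) => [|mk mkin].
    by rewrite big_const_seq count_predT szJ iter_addr_0 mulVf // gt_eqF.
  have /andP[_ m2] := pos _ mkin.
  by rewrite sumr_const_ord mulr1 divff // pnatr_eq0 -lt0n.
(* At d = D the smallness condition on higher coefficients is vacuous. *)
move=> p sp large; apply: (concl D) => //.
  by move=> i /andP[/leq_trans h /h]; rewrite ltnn.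
move: large; rewrite (wsE (fun n => cos (2 * p.[n%:R]))) normrM normfV.
rewrite [`|J%:R|]ger0_norm // ler_pdivlMl // => large.
rewrite -(ler_nat R).
have avg1 mk : mk \in mks -> `|ap_cos_avg N mk p| <= 1.
  move=> /pos/andP[_ m2]; rewrite /ap_cos_avg normrM normfV [`|_%:R|]ger0_norm //.
  rewrite ler_pdivrMr ?ltr0n // mul1r -[leRHS]mulr1 -sumr_const_ord.
  by apply: le_trans (ler_norm_sum _ _ _) (ler_sum _ _) => *; exact: cos_max.
have DJ : D%:R <= J%:R * (eps / 2).
  by rewrite -ler_pdivrMr // ltW // truncnS_gt.
set c := count _ _.
suff : \sum_(mk <- mks) `|ap_cos_avg N mk p| <= c%:R + J%:R * (eps / 2).
  move=> le2; have := ler_norm_sum mks (fun mk => ap_cos_avg N mk p) predT.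
  rewrite /ap_cos_avg in le2 *; move: large DJ; lra.
have -> : c%:R + J%:R * (eps / 2) =
    \sum_(mk <- mks) (((eps / 2 <= `|ap_cos_avg N mk p|)%R : nat)%:R + eps / 2).
  rewrite big_split /= -natr_sum /c -sumn_count sumnE big_map; congr (_%:R + _).
  by rewrite big_const_seq count_predT szJ iter_addr_0 -[RHS]mulr_natl.
rewrite big_seq [leRHS]big_seq; apply: ler_sum => mk mkin.
case: (leP (eps / 2)) => /= [_|/ltW]; last by rewrite add0r.
by apply: le_trans (avg1 _ mkin) _; rewrite lerDl ltW.
Qed.

(** * Rational approximation of the frequency *)

Lemma normr_sin_pi_int (R : realType) (l : int) : `|sin (pi * l%:~R : R)| = 0.
Proof.
apply/le_anti; rewrite normr_ge0 andbT mulrC.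
by apply: le_trans (normr_sinM_int _ _) _; rewrite sinpi normr0 mulr0.
Qed.

Lemma near_int_of_sin_small (R : realType) (rho : R) : 0 < rho ->
  exists2 eta : R, 0 < eta & forall x : R, `|sin (pi * x)| <= eta ->
  exists l : int, `|x - l%:~R| <= rho.
Proof.
(* The cap 1 / 4 keeps [pi * rh] where sine is positive and increasing. *)
move=> rho0; pose rh := Num.min rho (1 / 4).
have rh0 : 0 < rh by rewrite lt_min rho0 divr_gt0.
have rh1 : rh <= 1 / 4 by rewrite ge_min lexx orbT.
have pi0 : 0 < pi :> R := pi_gt0 R.
have s0 : 0 < sin (pi * rh) by apply: sin_gt0_pihalf; rewrite mulr_gt0 //= ltr_pM2l //; lra.
exists (sin (pi * rh)) => // x xs.
exists (Num.floor (x + 1 / 2)).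
set l := Num.floor _; set y := x - l%:~R.
apply: (@le_trans _ _ rh); last by rewrite ge_min lexx.
have /andP[l1 l2] := floor_itv (x + 1 / 2).
have y2 : `|y| <= 1 / 2.
  rewrite ler_norml /y; move: l1 l2; rewrite -/l intrD; lra.
rewrite leNgt; apply/negP => rhy.
have : sin (pi * rh) < sin (pi * `|y|).
  rewrite ltr_sin; first by rewrite ltr_pM2l.
    by rewrite in_itv /= ler_pM2l // -mulrN ler_pM2l //; lra.
  by rewrite in_itv /= ler_pM2l // -mulrN ler_pM2l //; move: (normr_ge0 y); lra.
have : sin (pi * `|y|) <= `|sin (pi * y)|.
  have [y0|y0] := leP 0 y; first by rewrite ger0_norm // ler_norm.
  by rewrite ltr0_norm // mulrN sinN -normrN ler_norm.
have -> : pi * y = pi * x + pi * (- l)%:~R by rewrite /y mulrNz; ring.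
move=> h1 h2; have := le_trans h1 (normr_sinD _ _).
rewrite normr_sin_pi_int addr0 => h3.
by have := lt_le_trans h2 (le_trans h3 xs); rewrite ltxx.
Qed.

Lemma sin_small (R : realType) (rho : R) : 0 < rho ->
  exists2 delta : R, 0 < delta & forall y : R, `|y| <= delta -> `|sin y| <= rho.
Proof.
move=> rho0.
have /cvgrPdist_lt/(_ _ rho0) := @continuous_sin R 0.
rewrite sin0 => /nbhs_ballP[d /= d0 dP].
exists (d / 2); first by rewrite divr_gt0.
move=> y yd; have := dP y; rewrite sub0r normrN => /(_ _)/ltW; apply.
by rewrite /ball /= sub0r normrN; move: yd d0; lra.
Qed.

Lemma common_denominator (I : finType) (F : I -> rat) :
  exists2 t : int, 0 < t & forall i, exists z : int, t%:~R * F i = z%:~R.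
Proof.
exists (\prod_i denq (F i)); first by apply: prodr_gt0 => i _; exact: denq_gt0.
move=> i; exists ((\prod_(j | j != i) denq (F j)) * numq (F i)).
by rewrite (bigD1 i) //= !intrM numqE; ring.
Qed.

(** P(n) - P(0) combines the coefficient vectors with weights n^(j+1); were their rank below [r],
    the image would lie in the translate by P(0) of their span. *)
Lemma hyperplane_fleeing_row_free (R : realType) (D r : nat) (P : polymap r) :
  deg_le D P -> hyperplane_fleeing R P ->
  row_free (\matrix_(i < r, j < D) ((P i)`_j.+1)%:~R : 'M[rat]_(r, D)).
Proof.
move=> dP fl; rewrite -(row_free_map (ratr : {rmorphism rat -> R})).
set A := (X in row_free X); apply: contrapT => notfree; apply: fl.
exists (polymap_eval R P 0), (<<A^T>>)%MS; split.
  rewrite mxrank_gen mxrank_tr ltn_neqAle rank_leq_row andbT.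
  by apply/negP => /eqP rk; apply: notfree; rewrite /row_free rk.
move=> n; rewrite genmxE; apply/submxP.
exists (\row_(j < D) (n%:~R) ^+ j.+1).
apply/rowP => i; rewrite !mxE.
rewrite horner_coef0 (horner_coef_wide _ (dP i)) big_ord_recl /= expr0 mulr1.
rewrite -intrB addrAC subrr add0r rmorph_sum /=; apply: eq_bigr => j _.
by rewrite /A !mxE rmorph_int intrM rmorphXn /= mulrC.
Qed.

(** A rational inverse cleared of denominators: [E] recovers t theta from the coefficients of
    P.theta with integer weights. *)
Lemma hyperplane_fleeing_left_inverse (R : realType) (D r : nat) (P : polymap r) :
  deg_le D P -> hyperplane_fleeing R P ->
  exists (t : int) (E : 'I_D -> 'I_r -> int), 0 < t /\
    forall i i', \sum_(j < D) (P i)`_j.+1 * E j i' = t *+ (i == i').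
Proof.
move=> dP fl; have /mulmxVp := hyperplane_fleeing_row_free dP fl.
set A := \matrix_(_, _) _; set V := pinvmx A => AV.
have [t t0 tV] := common_denominator (fun u : 'I_D * 'I_r => V u.1 u.2).
have [E EV] := choice tV.
exists t, (fun j i => E (j, i)); split => // i i'; apply: (@intr_inj rat).
rewrite rmorph_sum /=; have := congr1 (fun X : 'M[rat]_r => t%:~R * X i i') AV.
rewrite !mxE; have -> : t%:~R * (i == i')%:R = (t *+ (i == i'))%:~R :> rat.
  by case: (i == i'); rewrite ?mulr1 ?mulr0.
move=> <-; rewrite mulr_sumr.
apply: eq_bigr => j _; rewrite rmorphM /= -EV /= mulrCA. congr (_ * (_ * _)).
by rewrite mxE.
Qed.

Lemma dvdz_gcd_list (d q : int) (s : seq int) :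
  (d %| gcd_list s q)%Z = all (fun x => (d %| x)%Z) s && (d %| q)%Z.
Proof. by elim: s => //= x s IHs; rewrite dvdz_gcd IHs andbA. Qed.

Lemma gcd_list_ge0 (q : int) (s : seq int) : 0 <= q -> 0 <= gcd_list s q.
Proof. by case: s. Qed.

(** Dividing [a] and [t] by their gcd g gives a coprime family for which t' = t / g divides every
    nonconstant coefficient of a'.P. Multiplicative complexity yields t' <= Q, so t' divides Q!, and
    t = t' g divides Q! a_i. *)
Lemma mult_complexity_dvd (D r Q : nat) (P : polymap r) (a : 'I_r -> int) (t : int)
    (l : 'I_D -> int) :
  mult_complexity D Q P -> 0 < t ->
  (forall j : 'I_D, \sum_(i < r) a i * (P i)`_j.+1 = t * l j) ->
  forall i, (t %| Q`!%:Z * a i)%Z.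
Proof.
move=> mc t0 at_l i.
pose g := gcd_list [seq a i | i <- enum 'I_r] t.
have g0 : 0 <= g by apply: gcd_list_ge0; exact: ltW.
have /andP[/allP ga gt] : all (fun x => (g %| x)%Z) [seq a i | i <- enum 'I_r] && (g %| t)%Z.
  by rewrite -dvdz_gcd_list dvdzz.
have /choice[a' aE] : forall j, exists z, a j = z * g.
  by move=> j; apply/dvdzP; apply: ga; rewrite map_f // mem_enum.
have /dvdzP[t' tE] := gt.
have gn0 : g != 0 by apply: contraTneq t0; rewrite tE => ->; rewrite mulr0 ltxx.
have ggt0 : 0 < g by rewrite lt_def gn0.
have t'0 : 0 < t' by rewrite -(pmulr_lgt0 _ ggt0) -tE.
have e1 : gcd_list [seq a' i | i <- enum 'I_r] t' = 1.
  set e := gcd_list _ _.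
  have e0 : 0 <= e by apply: gcd_list_ge0; exact: ltW.
  have /andP[/allP ea et] : all (fun x => (e %| x)%Z) [seq a' i | i <- enum 'I_r] && (e %| t')%Z.
    by rewrite -dvdz_gcd_list dvdzz.
  have : (e * g %| g)%Z.
    suff : (e * g %| gcd_list [seq a i | i <- enum 'I_r] t)%Z by [].
    rewrite dvdz_gcd_list; apply/andP; split; last first.
      by have := et; rewrite -(dvdz_mul2r gn0) -tE.
    apply/allP => _ /mapP[j _ ->]; rewrite aE dvdz_mul2r //; apply: ea.
    by rewrite map_f // mem_enum.
  rewrite -[X in (_ %| X)%Z]mul1r dvdz_mul2r // dvdz1 => /eqP e1.
  by rewrite -[e]gez0_abs // e1.
have := mc a' t' e1; set G := gcd_list _ _ => GQ.
have t'G : (t' %| G)%Z.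
  rewrite dvdz_gcd_list dvdzz andbT; apply/allP => _ /mapP[j jD ->].
  move: jD; rewrite mem_iota add1n ltnS => /andP[]; case: j => // j _ jD.
  rewrite -(dvdz_mul2r gn0) mulr_suml; have := at_l (Ordinal jD) => /= E.
  under eq_bigr do rewrite mulrAC -aE.
  by rewrite E -tE dvdz_mulr.
have G0 : 0 <= G by apply: gcd_list_ge0; exact: ltW.
(* Without this, divisibility of [G] by [t'] would not bound [t']. *)
have Gn0 : G != 0.
  have := dvdz_gcd_list G t' [seq \sum_(i < r) a' i * (P i)`_j | j <- iota 1 D].
  rewrite -/G dvdzz => /esym/andP[_].
  by apply: contraTneq => ->; rewrite dvd0z gt_eqF.
have t'Q : (`|t'| <= Q)%N.
  apply: (@leq_trans `|G|%N).
    by apply: dvdn_leq; rewrite ?absz_gt0 // -dvdzE.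
  by rewrite -lez_nat gez0_abs.
rewrite aE tE mulrA dvdz_mul2r // dvdz_mulr // dvdzE /=.
by apply: dvdn_fact; rewrite t'Q absz_gt0 gt_eqF.
Qed.

(** Put x = k theta / pi. The coefficients of P.x are near integers l_j, so t x is near an integer
    vector a. The relations a.P_j = t l_j then hold exactly, and [mult_complexity_dvd] makes Q! a /
    t integral, hence Q! x nearly so. *)
Lemma near_torsion (R : realType) (D r Q k : nat) (P : polymap r) (rho : R) :
  deg_le D P -> mult_complexity D Q P -> hyperplane_fleeing R P -> 0 < rho ->
  exists2 eta : R, 0 < eta & forall theta : 'I_r -> R,
    (forall j, (0 < j <= D)%N ->
      `|sin (k%:R * \sum_i theta i * ((P i)`_j)%:~R)| <= eta) ->
    forall i, `|sin ((k * Q`!)%N%:R * theta i)| <= rho.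
Proof.
move=> dP mc fl rho0.
have [t [E [t0 PE]]] := hyperplane_fleeing_left_inverse dP fl.
have [delta delta0 sdelta] := sin_small rho0.
have pi0 : 0 < pi :> R := pi_gt0 R.
have pin0 : pi != 0 :> R by rewrite gt_eqF.
have tR : 1 <= t%:~R :> R by rewrite ler1z.
pose S1 : R := 1 + \sum_(j < D) \sum_(i < r) `|(E j i)%:~R|.
pose S2 : R := 1 + \sum_(j < D) \sum_(i < r) `|((P i)`_j.+1)%:~R|.
have S1gt0 : 0 < S1 by rewrite ltr_pwDl // sumr_ge0 // => j _; rewrite sumr_ge0.
have S2gt0 : 0 < S2 by rewrite ltr_pwDl // sumr_ge0 // => j _; rewrite sumr_ge0.
have S1E j : \sum_(i < r) `|(E j i)%:~R| <= S1.
  rewrite /S1 (bigD1 j) //= addrCA lerDl addr_ge0 // sumr_ge0 // => j' _.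
  by rewrite sumr_ge0.
(* The first entry forces the integer relations [al], the second brings the final error below
   [delta]. *)
pose r1 : R := Num.min (1 / (2 * (S1 * S2 + t%:~R))) (delta / (pi * Q`!%:R * S1)).
have den0 : 0 < 2 * (S1 * S2 + t%:~R) :> R.
  by rewrite mulr_gt0 // addr_gt0 ?mulr_gt0 // (lt_le_trans _ tR).
have den1 : 0 < pi * Q`!%:R * S1 by rewrite !mulr_gt0 // ltr0n fact_gt0.
have r10 : 0 < r1 by rewrite lt_min !divr_gt0.
have [eta eta0 near] := near_int_of_sin_small r10.
exists eta => // theta small.
pose x i := k%:R * theta i / pi.
pose y (j : 'I_D) : R := \sum_i x i * ((P i)`_j.+1)%:~R.
have yl j : exists l : int, `|y j - l%:~R| <= r1.
  apply: near; have := small j.+1; rewrite ltnS ltn_ord => /(_ isT).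
  congr (`|sin _| <= _); rewrite /y !mulr_sumr; apply: eq_bigr => i _.
  by rewrite /x; move: pin0; move: (pi : R) => u u0; field.
have [l lP] := choice yl.
pose a i := \sum_(j < D) l j * E j i.
have tx i : t%:~R * x i = \sum_(j < D) y j * (E j i)%:~R.
  under eq_bigr do rewrite mulr_suml.
  rewrite exchange_big /= (bigD1 i) //= [X in _ + X]big1 => [|i' ne].
    under eq_bigr do rewrite -mulrA -intrM.
    by rewrite -mulr_sumr -rmorph_sum /= PE eqxx addr0 mulrC.
  under eq_bigr do rewrite -mulrA -intrM.
  by rewrite -mulr_sumr -rmorph_sum /= PE (negbTE ne) mulr0.
have txa i : `|t%:~R * x i - (a i)%:~R| <= r1 * S1.
  rewrite tx /a rmorph_sum /= -sumrB.
  apply: le_trans (ler_norm_sum _ _ _) _.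
  apply: (@le_trans _ _ (\sum_(j < D) r1 * `|(E j i)%:~R|)).
    apply: ler_sum => j _; rewrite intrM -mulrBl normrM.
    by apply: ler_wpM2r => //; exact: lP.
  rewrite -mulr_sumr; apply: ler_wpM2l; first exact: ltW.
  rewrite /S1 -[leLHS]add0r; apply: lerD => //; apply: ler_sum => j _.
  by rewrite (bigD1 i) //= lerDl sumr_ge0.
(* Both sides are integers, at distance at most 1 / 2 by the choice of [r1]. *)
have al (j : 'I_D) : \sum_(i < r) a i * (P i)`_j.+1 = t * l j.
  apply/eqP; rewrite -subr_eq0 -normr_le0 -ltzD1 add0r -(ltr_int R).
  set z := _ - _.
  have -> : (`|z|%:~R : R) = `|z%:~R| by rewrite intr_norm.
  have -> : z%:~R = \sum_i ((a i)%:~R - t%:~R * x i) * ((P i)`_j.+1)%:~R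
       + t%:~R * (y j - (l j)%:~R) :> R.
    rewrite /z rmorphB /= rmorphM rmorph_sum /= /y mulrBr mulr_sumr.
    rewrite addrA -big_split /=; congr (_ - _); apply: eq_bigr => i _.
    by rewrite rmorphM /=; ring.
  apply: (@le_lt_trans _ _ (r1 * S1 * S2 + t%:~R * r1)).
    apply: le_trans (ler_normD _ _) (lerD _ _); last first.
      by rewrite normrM ger0_norm ?(le_trans _ tR) // ler_wpM2l ?(le_trans _ tR).
    apply: le_trans (ler_norm_sum _ _ _) _.
    apply: (@le_trans _ _ (\sum_i r1 * S1 * `|((P i)`_j.+1)%:~R|)).
      apply: ler_sum => i _; rewrite normrM; apply: ler_wpM2r => //.
      by rewrite distrC.
    rewrite -mulr_sumr; apply: ler_wpM2l; first by rewrite mulr_ge0 // ltW.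
    rewrite /S2 (bigD1 j) //= addrCA lerDl addr_ge0 // sumr_ge0 // => j' _.
    by rewrite sumr_ge0.
  have : r1 <= 1 / (2 * (S1 * S2 + t%:~R)) by rewrite ge_min lexx.
  by rewrite ler_pdivlMr //; lra.
move=> i; have /dvdzP[z zE] := mult_complexity_dvd mc t0 al i.
have zE' : Q`!%:R * (a i)%:~R = z%:~R * t%:~R :> R.
  by rewrite -intrM -zE intrM.
have t0R : 0 < t%:~R :> R by exact: lt_le_trans tR.
have -> : (k * Q`!)%N%:R * theta i = pi * z%:~R +
    pi * (Q`!%:R * (t%:~R * x i - (a i)%:~R) / t%:~R).
  rewrite mulrBr zE' /x natrM; move: pin0; move: (pi : R) => u u0.
  by field; rewrite u0 gt_eqF.
apply: le_trans (normr_sinD _ _) _; rewrite normr_sin_pi_int add0r.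
apply: sdelta; rewrite !normrM normfV.
rewrite [`|pi|]gtr0_norm // [`|t%:~R|]gtr0_norm // [`|Q`!%:R|]ger0_norm //.
apply: (@le_trans _ _ (pi * (Q`!%:R * (r1 * S1)))).
  rewrite ler_pM2l // ler_pdivrMr // -mulrA ler_wpM2l //.
  apply: le_trans (txa i) _; rewrite ler_peMr // mulr_ge0 // ltW //.
have : r1 <= delta / (pi * Q`!%:R * S1) by rewrite ge_min lexx orbT.
by rewrite ler_pdivlMr // !mulrA [r1 * pi]mulrC [pi * r1 * _]mulrAC.
Qed.

(** * Toeplitz positivity on a grid *)

Definition angle (R : realType) (r : nat) (theta : 'I_r -> R) (v : 'rV[int]_r) : R :=
  \sum_i (v 0 i)%:~R * theta i.

Lemma angleD (R : realType) r (theta : 'I_r -> R) u v :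
  angle theta (u + v) = angle theta u + angle theta v.
Proof.
by rewrite /angle -big_split; apply: eq_bigr => i _; rewrite mxE intrD mulrDl.
Qed.

Lemma angleN (R : realType) r (theta : 'I_r -> R) u :
  angle theta (- u) = - angle theta u.
Proof.
by rewrite /angle -sumrN; apply: eq_bigr => i _; rewrite mxE mulrNz mulNr.
Qed.

Lemma angleB (R : realType) r (theta : 'I_r -> R) u v :
  angle theta (u - v) = angle theta u - angle theta v.
Proof. by rewrite angleD angleN. Qed.

Lemma cos_doubleD_pi_int (R : realType) (x : R) (z : int) :
  cos (2 * (x + pi * z%:~R)) = cos (2 * x).
Proof.
apply/eqP; rewrite -subr_eq0 -normr_le0.
by apply: le_trans (dist_cos_double _ _) _; rewrite normr_sin_pi_int mulr0.
Qed.

Lemma sin_pi_rat_eq0 (R : realType) (u : int) (L : nat) :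
  sin (pi * (u%:~R / L.+1%:R) : R) = 0 -> (L.+1 %| u)%Z.
Proof.
move=> s0; have L0 : 0 < L.+1%:R :> R by [].
have e0 : 0 < 1 / 2 / L.+1%:R :> R by rewrite !divr_gt0.
have [eta eta0 near] := near_int_of_sin_small e0.
have [|l ll] := near (u%:~R / L.+1%:R); first by rewrite s0 normr0 ltW.
have : `|(u - l * L.+1)%:~R : R| < 1.
  have -> : (u - l * L.+1)%:~R = (u%:~R / L.+1%:R - l%:~R) * L.+1%:R :> R.
    by rewrite intrB intrM mulrBl divfK // gt_eqF.
  rewrite normrM [`|L.+1%:R|]ger0_norm // -ltr_pdivlMr //.
  apply: le_lt_trans ll _; rewrite ltr_pM2r ?invr_gt0 //; lra.
rewrite -intr_norm ltrz1 => lt1; apply/dvdzP; exists l.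
by apply/eqP; rewrite -subr_eq0 -normr_le0 -ltzD1 add0r.
Qed.

(** At doubled angles these are the characters of (Z/(L+1))^r. *)
Definition grid (R : realType) (r L : nat) (k : {ffun 'I_r -> 'I_L.+1}) : 'I_r -> R :=
  fun i => pi * ((k i)%:R / L.+1%:R).

Definition ffun_row (r L : nat) (a : {ffun 'I_r -> 'I_L.+1}) : 'rV[int]_r :=
  \row_i (a i)%:Z.

(* The sum [S phi] is invariant under [phi -> phi + alpha], where [alpha] is the angle of one
   grid step in direction [i0], while [S (phi + alpha) + S (phi - alpha)] is
   [2 cos (2 alpha) S phi]. *)
Lemma grid_cos_sum0 (R : realType) (r L : nat) (u : 'rV[int]_r) (i0 : 'I_r) (phi : R) :
  ~~ (L.+1%:Z %| (u 0 i0)%R)%Z ->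
  \sum_(k : {ffun 'I_r -> 'I_L.+1}) cos (2 * (angle (grid R k) u + phi)) = 0.
Proof.
move=> ndiv; pose S phi := \sum_(k : {ffun 'I_r -> 'I_L.+1}) cos (2 * (angle (grid R k) u + phi)).
pose alpha : R := pi * ((u 0 i0)%:~R / L.+1%:R).
have L0 : L.+1%:R != 0 :> R by [].
have S_shift psi : S psi = S (psi + alpha).
  pose delta : {ffun 'I_r -> 'I_L.+1} := [ffun i => if i == i0 then inZp 1 else 0].
  rewrite /S (reindex_inj (addIr delta)) /=; apply: eq_bigr => k _.
  (* Records whether the unit step wraps round; a wrap changes the angle by an integer multiple of
     pi. *)
  pose z : int := if (k i0).+1 == L.+1 then 1 else 0.
  have kz : ((k + delta)%R i0)%:R = (k i0)%:R + 1 - z%:~R * L.+1%:R :> R.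
    rewrite !ffunE eqxx /= modnDmr addn1 /z; case: eqP => [kE|ne].
      by rewrite kE modnn mul1r natr1 kE subrr.
    rewrite modn_small ?mul0r ?subr0 ?natr1 //.
    by rewrite ltn_neqAle ltn_ord andbT; apply/eqP.
  have E : angle (grid R (k + delta)) u =
      angle (grid R k) u + alpha + pi * (- (z * u 0 i0))%:~R.
    rewrite /angle (bigD1 i0) //= [in RHS](bigD1 i0) //=.
    rewrite [X in _ + X](eq_bigr (fun i => (u 0 i)%:~R * grid R k i)); last first.
      by move=> i /negbTE ne; rewrite /grid !ffunE ne addr0.
    set rest := \sum_(i | _) _.
    rewrite /grid kz /alpha mulrNz intrM; move: (pi : R) rest => c rest.
    by field; rewrite nat1r pnatr_eq0.
  by rewrite E -[RHS](cos_doubleD_pi_int _ (- (z * u 0 i0))); congr cos; ring.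
have two : S (phi + alpha) + S (phi - alpha) = 2 * cos (2 * alpha) * S phi.
  rewrite /S -big_split mulr_sumr; apply: eq_bigr => k _ /=.
  set x := angle _ _.
  have -> : 2 * (x + (phi + alpha)) = 2 * (x + phi) + 2 * alpha by ring.
  have -> : 2 * (x + (phi - alpha)) = 2 * (x + phi) - 2 * alpha by ring.
  by rewrite cosB cosD; ring.
move: two; rewrite -S_shift (S_shift (phi - alpha)) subrK cos_double => two.
have : sin alpha ^+ 2 * S phi = 0 by move: two; lra.
move=> /eqP; rewrite mulf_eq0 sqrf_eq0 => /orP[/eqP s0|/eqP //].
by move: ndiv; rewrite (sin_pi_rat_eq0 s0).
Qed.

(** Orthogonality of characters in real form. *)
Lemma grid_cos_sum (R : realType) (r L : nat) (u : 'rV[int]_r) :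
  \sum_(k : {ffun 'I_r -> 'I_L.+1}) cos (2 * angle (grid R k) u)
  = (L.+1 ^ r)%:R * [forall i, (L.+1%:Z %| (u 0 i)%R)%Z]%:R.
Proof.
case: forallP => [div|/existsNP[i /negP ndiv]]; last first.
  rewrite mulr0 -[RHS](grid_cos_sum0 0 ndiv).
  by apply: eq_bigr => k _; rewrite addr0.
rewrite mulr1 (eq_bigr (fun=> 1)) => [|k _].
  by rewrite sumr_const card_ffun !card_ord.
have /choice[z zE] : forall i, exists z : int, u 0 i = z * L.+1%:Z.
  by move=> i; apply/dvdzP.
have := cos_doubleD_pi_int (0 : R) (\sum_i z i * (k i)%:Z).
rewrite mulr0 cos0 add0r; apply: etrans.
congr (cos (2 * _)); rewrite /angle /grid rmorph_sum mulr_sumr; apply: eq_bigr => i _.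
rewrite zE !intrM; move: (pi : R) => c.
by field; rewrite nat1r pnatr_eq0.
Qed.

Definition cyc_shift (r L : nat) (a : {ffun 'I_r -> 'I_L.+1}) (v : 'rV[int]_r) :
    {ffun 'I_r -> 'I_L.+1} :=
  [ffun i => inZp `|(((a i)%:Z + v 0 i)%R %% L.+1)%Z|%N].

Lemma cyc_shiftE (r L : nat) (a : {ffun 'I_r -> 'I_L.+1}) (v : 'rV[int]_r) i :
  (cyc_shift a v i)%:Z = (((a i)%:Z + v 0 i)%R %% L.+1)%Z.
Proof.
rewrite ffunE /= modn_small; first by rewrite gez0_abs // modz_ge0.
by rewrite -ltz_nat gez0_abs ?modz_ge0 // ltz_pmod.
Qed.

Lemma cyc_shift_eq (r L : nat) (a b : {ffun 'I_r -> 'I_L.+1}) (v : 'rV[int]_r) :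
  [forall i, (L.+1%:Z %| ((v + ffun_row a - ffun_row b) 0 i)%R)%Z] = (b == cyc_shift a v).
Proof.
have rowE i : (v + ffun_row a - ffun_row b) 0 i = (a i)%:Z + v 0 i - (b i)%:Z.
  by rewrite !mxE [v 0 i + _]addrC.
apply/forallP/eqP => [div|bE i].
  apply/ffunP => i; apply/val_inj/eqP; rewrite -eqz_nat cyc_shiftE.
  have := div i; rewrite rowE -eqz_mod_dvd => /eqP ->.
  by rewrite modz_small // ltz_nat ltn_ord.
by rewrite rowE bE cyc_shiftE -eqz_mod_dvd modz_mod.
Qed.

(** Weight the trigonometric polynomial at each grid point by the squared modulus of the Fourier
    transform of [y], and sum: orthogonality turns this nonnegative total into (L+1)^r times the
    form. *)
Lemma toeplitz_ge0 (R : realType) (r L : nat) (s : seq (R * 'rV[int]_r))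
    (y : {ffun 'I_r -> 'I_L.+1} -> R) :
  (forall theta : 'I_r -> R, 0 <= \sum_(w <- s) w.1 * cos (2 * angle theta w.2)) ->
  0 <= \sum_(w <- s) w.1 * \sum_a y a * y (cyc_shift a w.2).
Proof.
move=> pos; pose G := {ffun 'I_r -> 'I_L.+1}.
pose x (k a : G) : R := 2 * angle (grid R k) (ffun_row a).
have : 0 <= \sum_(k : G) (\sum_(w <- s) w.1 * cos (2 * angle (grid R k) w.2)) *
    ((\sum_a y a * cos (x k a)) ^+ 2 + (\sum_a y a * sin (x k a)) ^+ 2).
  by apply: sumr_ge0 => k _; rewrite mulr_ge0 // addr_ge0 // sqr_ge0.
have sq k : (\sum_a y a * cos (x k a)) ^+ 2 + (\sum_a y a * sin (x k a)) ^+ 2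
    = \sum_a \sum_b y a * y b * cos (x k a - x k b).
  rewrite !expr2 !mulr_suml -big_split /=; apply: eq_bigr => a _.
  by rewrite !mulr_sumr -big_split; apply: eq_bigr => b _; rewrite cosB /=; ring.
have LR : 0 < (L.+1 ^ r)%:R :> R by rewrite ltr0n expn_gt0.
suff -> : \sum_(k : G) (\sum_(w <- s) w.1 * cos (2 * angle (grid R k) w.2)) *
    ((\sum_a y a * cos (x k a)) ^+ 2 + (\sum_a y a * sin (x k a)) ^+ 2)
    = (L.+1 ^ r)%:R * \sum_(w <- s) w.1 * \sum_a y a * y (cyc_shift a w.2).
  by rewrite pmulr_rge0.
under eq_bigr => k _ do rewrite sq mulr_suml.
rewrite exchange_big mulr_sumr; apply: eq_bigr => -[c v] _ /=.
under eq_bigr => k _ do rewrite -mulrA.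
rewrite -mulr_sumr [RHS]mulrCA; congr (_ * _).
under [LHS]eq_bigr => k _ do rewrite mulr_sumr.
rewrite exchange_big /=.
have prod k a b : cos (2 * angle (grid R k) v) * (y a * y b * cos (x k a - x k b))
    = y a * y b / 2 * (cos (2 * angle (grid R k) (v + ffun_row a - ffun_row b))
                      + cos (2 * angle (grid R k) (v + ffun_row b - ffun_row a))).
  rewrite !angleB !angleD /x -mulrBr; set t := angle _ v; set p := angle _ _ ; set q := angle _ _.
  have -> : 2 * (t + p - q) = 2 * t + 2 * (p - q) by ring.
  have -> : 2 * (t + q - p) = 2 * t - 2 * (p - q) by ring.
  by rewrite cosB cosD; field.
have inner a b : \sum_k cos (2 * angle (grid R k) v) * (y a * y b * cos (x k a - x k b))
    = (L.+1 ^ r)%:R / 2 * (y a * y b * (b == cyc_shift a v)%:R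
                           + y b * y a * (a == cyc_shift b v)%:R).
  under eq_bigr => k _ do rewrite prod.
  by rewrite -mulr_sumr big_split /= !grid_cos_sum !cyc_shift_eq; field.
under [LHS]eq_bigr => a _.
  under eq_bigr => k _ do rewrite mulr_sumr.
  rewrite exchange_big /=.
  under eq_bigr => b _ do rewrite inner.
  rewrite -mulr_sumr big_split /=.
  over.
rewrite -mulr_sumr big_split /=.
have pick (u : G) : \sum_b y u * y b * (b == cyc_shift u v)%:R = y u * y (cyc_shift u v).
  rewrite (bigD1 (cyc_shift u v)) //= eqxx mulr1 big1 ?addr0 // => b /negbTE ->.
  by rewrite mulr0.
rewrite [X in _ + X]exchange_big /=.
under [in LHS]eq_bigr => a _ do rewrite pick.
by field.
Qed.

(** * Correlations along the action *)

Section BoundedMeasurable.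
Context (R : realType) (d : measure_display) (X : measurableType d) (mu : probability X R).
Implicit Types f g : X -> R.

Definition bounded_measurable f :=
  measurable_fun [set: X] f /\ exists M : R, forall x, `|f x| <= M.

Lemma bounded_measurable_cst c : bounded_measurable (fun=> c).
Proof. by split; [exact: measurable_cst | exists `|c|]. Qed.

Lemma bounded_measurableD f g : bounded_measurable f -> bounded_measurable g ->
  bounded_measurable (fun x => f x + g x).
Proof.
move=> [mf [M fM]] [mg [N gN]]; split; first exact: measurable_funD.
by exists (M + N) => x; apply: le_trans (ler_normD _ _) (lerD _ _).
Qed.

Lemma bounded_measurableM f g : bounded_measurable f -> bounded_measurable g ->
  bounded_measurable (fun x => f x * g x).
Proof.
move=> [mf [M fM]] [mg [N gN]]; split; first exact: measurable_funM.
by exists (M * N) => x; rewrite normrM ler_pM.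
Qed.

Lemma bounded_measurable_sum (I : Type) (s : seq I) (F : I -> X -> R) :
  (forall i, bounded_measurable (F i)) ->
  bounded_measurable (fun x => \sum_(i <- s) F i x).
Proof.
move=> bF; elim: s => [|i s IHs].
  by under eq_fun do rewrite big_nil; exact: bounded_measurable_cst.
by under eq_fun do rewrite big_cons; exact: bounded_measurableD.
Qed.

Lemma bounded_measurable_integrable f :
  bounded_measurable f -> mu.-integrable [set: X] (EFin \o f).
Proof.
move=> [mf [M fM]]; apply: measurable_bounded_integrable => //.
  by apply: le_lt_trans (probability_le1 mu _) _ => //; rewrite ltry.
by exists M; split; rewrite ?num_real // => y My x _ /=; apply: le_trans (ltW My).
Qed.

Lemma Rintegral_sum (I : Type) (s : seq I) (F : I -> X -> R) :
  (forall i, bounded_measurable (F i)) ->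
  \int[mu]_x (\sum_(i <- s) F i x) = \sum_(i <- s) \int[mu]_x F i x.
Proof.
move=> bF; elim: s => [|i s IHs].
  rewrite big_nil; under eq_Rintegral do rewrite big_nil.
  by rewrite Rintegral_cst ?mul0r.
rewrite big_cons -IHs; under eq_Rintegral do rewrite big_cons.
rewrite RintegralD //; apply: bounded_measurable_integrable => //.
exact: bounded_measurable_sum.
Qed.

Lemma Rintegral_scale c f : bounded_measurable f ->
  \int[mu]_x (c * f x) = c * \int[mu]_x f x.
Proof. by move=> bf; rewrite RintegralZl //; exact: bounded_measurable_integrable. Qed.

End BoundedMeasurable.

Lemma bernoulli_ineq (R : realType) (x : R) (n : nat) :
  0 <= x <= 1 -> 1 - n%:R * x <= (1 - x) ^+ n.
Proof.
move=> /andP[x0 x1]; elim: n => [|n IHn]; first by rewrite mul0r subr0 expr0.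
have y0 : 0 <= 1 - x by rewrite subr_ge0.
apply: le_trans (_ : (1 - x) * (1 - n%:R * x) <= _); last first.
  by rewrite exprS ler_wpM2l.
have : 0 <= n%:R * (x * x) by rewrite !mulr_ge0.
by rewrite -[n.+1%:R]natr1; move: (n%:R : R) => k; lra.
Qed.

(** Counts the residues that a shift of size at most [V] moves without wrapping round. *)
Lemma card_interior (L V : nat) :
  (L.+1 - V.*2 <= #|[pred k : 'I_L.+1 | V <= k < L.+1 - V]|)%N.
Proof.
have bound (k : 'I_(L.+1 - V.*2)) : (k + V < L.+1)%N by have := ltn_ord k; lia.
pose g k : 'I_L.+1 := Ordinal (bound k).
have gi : injective g by move=> k k' /(congr1 val) /= /addIn /val_inj.
rewrite -[leqLHS]card_ord -(card_codom gi); apply: subset_leq_card.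
apply/fintype.subsetP => _ /codomP[k ->]; rewrite inE /=; have := ltn_ord k; lia.
Qed.

Section Correlation.
Context (R : realType) (d : measure_display) (X : measurableType d)
  (mu : probability X R) (r : nat) (T : 'rV[int]_r -> X -> X).
Hypothesis Tmp : mp_action mu T.
Variable B : set X.
Hypothesis mB : measurable B.

Definition correlation (v : 'rV[int]_r) : R := fine (mu (B `&` T v @^-1` B)).

Let visit (u : 'rV[int]_r) (x : X) : R := \1_B (T u x).

Lemma bounded_measurable_visit u : bounded_measurable (visit u).
Proof.
case: Tmp => _ [_ [mT _]]; split; last first.
  by exists 1 => x; rewrite /visit indicE; case: (_ \in _); rewrite ?normr0 ?normr1.
exact: (measurableT_comp (measurable_indic mB) (mT u)).
Qed.

Lemma measurable_action_preimage u A : measurable A -> measurable (T u @^-1` A).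
Proof. by case: Tmp => _ [_ [mT _]] mA; rewrite -[_ @^-1` _]setTI; exact: mT. Qed.

Lemma Rintegral_visitM a b : \int[mu]_x (visit a x * visit b x) = correlation (b - a).
Proof.
case: (Tmp) => _ [TD [_ Tmu]].
rewrite /Rintegral /correlation.
have mA : measurable (B `&` T (b - a) @^-1` B).
  by apply: measurableI => //; exact: measurable_action_preimage.
rewrite -(Tmu a _ mA) -[X in mu X]setIT -integral_indic //; last first.
  exact: measurable_action_preimage.
congr fine; apply: eq_integral => x _; congr EFin.
rewrite /visit !indicE -natrM mulnb; congr (_%:R); congr nat_of_bool.
apply/andP/idP; rewrite !inE /=; rewrite -TD subrK; tauto.
Qed.

Lemma Rintegral_visit a : \int[mu]_x visit a x = fine (mu B).
Proof.
case: (Tmp) => T0 _.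
have <- : correlation (a - a) = fine (mu B).
  rewrite /correlation subrr; congr (fine (mu _)).
  by apply/seteqP; split => x /=; rewrite T0 // => -[].
rewrite -Rintegral_visitM; apply: eq_Rintegral => x _.
by rewrite /visit indicE; case: (_ \in _); rewrite ?mulr1 ?mulr0.
Qed.

Lemma correlationN v : correlation (- v) = correlation v.
Proof.
rewrite -(sub0r v) -[in RHS](subr0 v) -!Rintegral_visitM.
by apply: eq_Rintegral => x _; rewrite mulrC.
Qed.

Lemma correlation_itv v : 0 <= correlation v <= 1.
Proof.
have mA : measurable (B `&` T v @^-1` B).
  by apply: measurableI => //; exact: measurable_action_preimage.
rewrite fine_ge0 //= -lee_fin fineK ?probability_le1 //.
exact: fin_num_measure.
Qed.

(** Toeplitz positivity for the visits of one orbit to a box, integrated over [x], gives the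
    inequality with cyclic shifts. These agree with true shifts outside a boundary layer of relative
    size O(1 / L), and L is arbitrary. *)
Lemma nonneg_trig_correlation (s : seq (R * 'rV[int]_r)) :
  (forall theta : 'I_r -> R, 0 <= \sum_(w <- s) w.1 * cos (2 * angle theta w.2)) ->
  0 <= \sum_(w <- s) w.1 * correlation w.2.
Proof.
move=> pos.
have cyc L : 0 <= \sum_(w <- s) w.1 *
    \sum_(a : {ffun 'I_r -> 'I_L.+1})
       correlation (ffun_row (cyc_shift a w.2) - ffun_row a).
  have : 0 <= \int[mu]_x \sum_(w <- s) w.1 *
      \sum_(a : {ffun 'I_r -> 'I_L.+1})
         visit (ffun_row a) x * visit (ffun_row (cyc_shift a w.2)) x.
    apply: Rintegral_ge0 => x _.
    exact: (@toeplitz_ge0 _ _ _ _ (fun a => visit (ffun_row a) x)).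
  have bM a b : bounded_measurable (fun x => visit a x * visit b x).
    by apply: bounded_measurableM; exact: bounded_measurable_visit.
  have bS (w : R * 'rV[int]_r) : bounded_measurable (fun x =>
      \sum_(a : {ffun 'I_r -> 'I_L.+1})
         visit (ffun_row a) x * visit (ffun_row (cyc_shift a w.2)) x).
    exact: bounded_measurable_sum.
  rewrite Rintegral_sum => [|w]; last first.
    by apply: bounded_measurableM => //; exact: bounded_measurable_cst.
  congr (0 <= _); apply: eq_bigr => w _.
  rewrite Rintegral_scale // Rintegral_sum //.
  by congr (_ * _); apply: eq_bigr => a _; exact: Rintegral_visitM.
pose V := (\max_(w <- s) \max_(i < r) `|(w.2 0 i)%R|)%N.
pose C : R := \sum_(w <- s) `|w.1|.
have C0 : 0 <= C by apply: sumr_ge0.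
have Vle w i : w \in s -> (`|(w.2 0 i)%R| <= V)%N.
  move=> ws; apply: (@leq_trans (\max_(i < r) `|(w.2 0 i)%R|)%N).
    exact: (@leq_bigmax _ (fun i => `|(w.2 0 i)%R|%N)).
  apply: (leq_bigmax_seq (P := predT)) => //.
have err L w : (V.*2 <= L.+1)%N -> w \in s ->
  `|(L.+1 ^ r)%:R * correlation w.2 - \sum_(a : {ffun 'I_r -> 'I_L.+1})
       correlation (ffun_row (cyc_shift a w.2) - ffun_row a)|
  <= (L.+1 ^ r)%:R * (r%:R * (V.*2%:R / L.+1%:R)).
  move=> VL ws; pose G := {ffun 'I_r -> 'I_L.+1}.
  pose inner := [pred a : G | a \in ffun_on [pred k : 'I_L.+1 | V <= k < L.+1 - V]%N].
  have -> : (L.+1 ^ r)%:R * correlation w.2 = \sum_(a : G) correlation w.2.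
    by rewrite sumr_const card_ffun !card_ord mulr_natl.
  rewrite -sumrB; apply: le_trans (ler_norm_sum _ _ _) _.
  (* On the inner box the two correlations coincide; elsewhere they differ by at most 1. *)
  apply: (@le_trans _ _ (\sum_(a : G) (1 - (a \in inner)%:R))).
    apply: ler_sum => a _; case: (boolP (a \in inner)) => [ain|_]; last first.
      rewrite subr0; have := correlation_itv w.2.
      have := correlation_itv (ffun_row (cyc_shift a w.2) - ffun_row a).
      by rewrite ler_norml; lra.
    suff -> : ffun_row (cyc_shift a w.2) - ffun_row a = w.2 by rewrite !subrr normr0.
    apply/rowP => i; rewrite !mxE cyc_shiftE.
    have := Vle _ i ws; have /ffun_onP/(_ i) := ain; rewrite inE => /andP[a1 a2] v1.
    rewrite modz_small; first by ring.
    clearbody V; move: VL a1 a2 v1; move: (nat_of_ord (a i)) (w.2 0 i) => p z.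
    by clear; lia.
  rewrite sumrB sumr_const card_ffun !card_ord -natr_sum.
  have -> : (\sum_(a : G) (a \in inner) = #|inner|)%N.
    by rewrite -sum1_card [RHS]big_mkcond; apply: eq_bigr => a _; case: (a \in inner).
  rewrite (eq_card (B := ffun_on [pred k : 'I_L.+1 | V <= k < L.+1 - V]%N)) //.
  rewrite card_ffun_on card_ord.
  have LR : 0 < L.+1%:R :> R by [].
  have le1 : ((1 - V.*2%:R / L.+1%:R) * L.+1%:R) ^+ r
      <= (#|[pred k : 'I_L.+1 | V <= k < L.+1 - V]%N| ^ r)%:R :> R.
    rewrite mulrBl mul1r divfK ?gt_eqF // -natrB // natrX.
    by rewrite lerXn2r ?nnegrE // ler_nat card_interior.
  have := @bernoulli_ineq R (V.*2%:R / L.+1%:R) r.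
  rewrite divr_ge0 //= ler_pdivrMr // mul1r ler_nat VL => /(_ isT) le2.
  have le3 := ler_wpM2r (exprn_ge0 r (ltW LR)) le2.
  have LrE : (L.+1 ^ r)%:R = L.+1%:R ^+ r :> R by rewrite natrX.
  rewrite exprMn in le1; have := le_trans le3 le1; rewrite LrE.
  move: (V.*2%:R / L.+1%:R) (L.+1%:R ^+ r) (r%:R : R) => x y z.
  by move: (_ ^ r)%:R => t; lra.
have key L : (V.*2 <= L.+1)%N ->
    - (C * (r%:R * V.*2%:R)) <= (\sum_(w <- s) w.1 * correlation w.2) * L.+1%:R.
  move=> VL.
  have LR : 0 < L.+1%:R :> R by [].
  have LrR : 0 < (L.+1 ^ r)%:R :> R by rewrite ltr0n expn_gt0.
  have : `|(L.+1 ^ r)%:R * \sum_(w <- s) w.1 * correlation w.2 - \sum_(w <- s) w.1 *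
    \sum_(a : {ffun 'I_r -> 'I_L.+1})
       correlation (ffun_row (cyc_shift a w.2) - ffun_row a)|
    <= C * ((L.+1 ^ r)%:R * (r%:R * (V.*2%:R / L.+1%:R))).
    rewrite mulr_sumr -sumrB mulr_suml; apply: le_trans (ler_norm_sum _ _ _) _.
    rewrite big_seq [leRHS]big_seq; apply: ler_sum => w ws.
    by rewrite mulrCA -mulrBr normrM ler_wpM2l // err.
  rewrite ler_norml => /andP[+ _] => low.
  have := cyc L; move: low; set S := \sum_(w <- s) _; set S' := \sum_(w <- s) _ => low S'0.
  have : (L.+1 ^ r)%:R * - (C * (r%:R * (V.*2%:R / L.+1%:R))) <= (L.+1 ^ r)%:R * S.
    move: low; move: (r%:R * _) ((L.+1 ^ r)%:R : R) => e K; lra.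
  rewrite ler_pM2l // => lowS.
  rewrite -[leLHS](@divfK _ L.+1%:R) ?gt_eqF // ler_pM2r //.
  by move: lowS; rewrite mulNr !mulrA.
rewrite leNgt; apply/negP => neg.
set S := \sum_(w <- s) _ in key neg.
(* Large enough for a negative sum times [L.+1] to violate [key]. *)
pose L := (V.*2 + Num.truncn (C * (r%:R * V.*2%:R) / - S))%N.
have nS : 0 < - S by rewrite oppr_gt0.
have := key L; rewrite /L -addnS leq_addr => /(_ isT).
rewrite leNgt => /negP; apply.
rewrite -ltrN2 opprK -mulNr [ltRHS]mulrC -ltr_pdivrMr //.
by apply: lt_le_trans (truncnS_gt _) _; rewrite ler_nat leq_addl.
Qed.

End Correlation.

(** * Visit averages *)

(** The integral of the square of [f + g - 2 * c], expanded; [c] is meant as the common mean of [f]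
    and [g]. *)
Lemma Rintegral_sqr_sum_ge0 (R : realType) (d : measure_display) (X : measurableType d)
    (mu : probability X R) (c : R) (f g : X -> R) :
  bounded_measurable f -> bounded_measurable g ->
  0 <= \int[mu]_x (f x * f x) + \int[mu]_x (g x * g x) + 2 * \int[mu]_x (f x * g x)
       - 4 * c * \int[mu]_x f x - 4 * c * \int[mu]_x g x + 4 * c ^+ 2.
Proof.
move=> bf bg.
have : 0 <= \int[mu]_x (f x + g x - 2 * c) ^+ 2.
  by apply: Rintegral_ge0 => x _; exact: sqr_ge0.
have -> : \int[mu]_x (f x + g x - 2 * c) ^+ 2 =
    \int[mu]_x (f x * f x + (g x * g x + (2 * (f x * g x) +
       (- 4 * c * f x + (- 4 * c * g x + 4 * c ^+ 2))))).
  by apply: eq_Rintegral => x _; ring.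
have bff := bounded_measurableM bf bf; have bgg := bounded_measurableM bg bg.
have bfg := bounded_measurableM bf bg.
have scale (a : R) (h : X -> R) : bounded_measurable h -> bounded_measurable (fun x : X => a * h x).
  by apply: bounded_measurableM; exact: bounded_measurable_cst.
have bcst : bounded_measurable (fun _ : X => 4 * c ^+ 2) by exact: bounded_measurable_cst.
have split h k : bounded_measurable h -> bounded_measurable k ->
    \int[mu]_x (h x + k x) = \int[mu]_x h x + \int[mu]_x k x.
  by move=> bh bk; rewrite RintegralD //; exact: bounded_measurable_integrable.
have b5 := bounded_measurableD (scale (- 4 * c) _ bg) bcst.
have b4 := bounded_measurableD (scale (- 4 * c) _ bf) b5.
have b3 := bounded_measurableD (scale 2 _ bfg) b4.
have b2 := bounded_measurableD bgg b3.
rewrite (split _ _ bff b2) (split _ _ bgg b3) (split _ _ (scale 2 _ bfg) b4).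
rewrite (split _ _ (scale (- 4 * c) _ bf) b5) (split _ _ (scale (- 4 * c) _ bg) bcst).
have -> : \int[mu]_x (4 * c ^+ 2) = 4 * c ^+ 2.
  by rewrite Rintegral_cst // [fine _](congr1 fine (probability_setT mu)) mulr1.
rewrite !Rintegral_scale //.
by congr (0 <= _); ring.
Qed.

Section VisitAverage.
Context (R : realType) (d : measure_display) (X : measurableType d)
  (mu : probability X R) (r : nat) (T : 'rV[int]_r -> X -> X).
Hypothesis Tmp : mp_action mu T.
Variable B : set X.
Hypothesis mB : measurable B.
Variable q : nat.

Definition box_vec (m : nat) (a : {ffun 'I_r -> 'I_m}) : 'rV[int]_r :=
  \row_i (q%:Z * ((a i)%:Z + 1)).

Let avg (m : nat) (x : X) : R := @visit_avg R X r T q B x m.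

Lemma visit_avg_itv m x : 0 <= avg m x <= 1.
Proof.
rewrite /avg /visit_avg divr_ge0 ?exprn_ge0 ?sumr_ge0 //=.
(* A zero denominator makes the quotient 0. *)
case: (posnP (m ^ r)) => [m0|m0].
  by rewrite -natrX m0 invr0 mulr0.
rewrite -natrX ler_pdivrMr ?ltr0n // mul1r.
have -> : (m ^ r)%:R = \sum_(a : {ffun 'I_r -> 'I_m}) 1 :> R.
  by rewrite sumr_const card_ffun !card_ord.
by apply: ler_sum => a _; rewrite indicE; case: (_ \in _).
Qed.

Lemma visit_avg_action m u x :
  avg m (T u x) = (\sum_(a : {ffun 'I_r -> 'I_m}) \1_B (T (box_vec a + u) x)) / m%:R ^+ r.
Proof.
case: Tmp => _ [TD _]; rewrite /avg /visit_avg; congr (_ / _).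
by apply: eq_bigr => a _; rewrite TD.
Qed.

Lemma bounded_measurable_visit_avg m u : bounded_measurable (fun x => avg m (T u x)).
Proof.
under eq_fun do rewrite visit_avg_action.
apply: bounded_measurableM; last exact: bounded_measurable_cst.
by apply: bounded_measurable_sum => a; exact: (bounded_measurable_visit Tmp mB).
Qed.

Lemma Rintegral_visit_avg m u : (0 < m)%N ->
  \int[mu]_x avg m (T u x) = fine (mu B).
Proof.
move=> m0; under eq_Rintegral do rewrite visit_avg_action mulrC.
have bv v : bounded_measurable (fun x => \1_B (T v x) : R).
  exact: (bounded_measurable_visit Tmp mB).
rewrite Rintegral_scale ?Rintegral_sum //; last exact: bounded_measurable_sum.
under eq_bigr do rewrite (Rintegral_visit Tmp mB).
rewrite sumr_const card_ffun !card_ord -(mulr_natl (fine (mu B))) natrX mulKf //.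
by rewrite expf_neq0 // pnatr_eq0 -lt0n.
Qed.

(** The inner product of G_m with its translate by [v], written through [correlation] so that it
    enters the certificate linearly. *)
Definition avg_correlation (m : nat) (v : 'rV[int]_r) : R :=
  (m%:R ^+ r * m%:R ^+ r)^-1 *
  \sum_(ab : {ffun 'I_r -> 'I_m} * {ffun 'I_r -> 'I_m})
     correlation mu T B (v + (box_vec ab.1 - box_vec ab.2)).

Lemma Rintegral_visit_avgM m u v :
  \int[mu]_x (avg m (T u x) * avg m (T v x)) = avg_correlation m (v - u).
Proof.
rewrite /avg_correlation.
rewrite -(pair_bigA _ (fun a b => correlation mu T B (v - u + (box_vec a - box_vec b)))) /=.
have bv a b : bounded_measurable (fun x => \1_B (T a x) * \1_B (T b x) : R).
  by apply: bounded_measurableM; exact: (bounded_measurable_visit Tmp mB).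
transitivity (\int[mu]_x ((m%:R ^+ r * m%:R ^+ r)^-1 *
   \sum_(b : {ffun 'I_r -> 'I_m}) \sum_(a : {ffun 'I_r -> 'I_m})
     \1_B (T (box_vec a + u) x) * \1_B (T (box_vec b + v) x))).
  apply: eq_Rintegral => x _; rewrite !visit_avg_action exchange_big /=.
  under [in RHS]eq_bigr => a _ do rewrite -mulr_sumr.
  by rewrite -mulr_suml invfM; ring.
rewrite Rintegral_scale; last by do 2![apply: bounded_measurable_sum => ?]; exact: bv.
congr (_ * _); rewrite Rintegral_sum; last by move=> b; apply: bounded_measurable_sum => a.
apply: eq_bigr => b _; rewrite Rintegral_sum //; apply: eq_bigr => a _.
rewrite (Rintegral_visitM Tmp mB); congr correlation.
by rewrite opprD addrACA [RHS]addrC.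
Qed.

(** G_m and its translate share the mean mu(B) and the energy [avg_correlation m 0]; expand the
    square of their sum minus 2 mu(B). *)
Lemma avg_correlation_ge m v : (0 < m)%N ->
  2 * fine (mu B) ^+ 2 - avg_correlation m 0 <= avg_correlation m v.
Proof.
move=> m0; set c := fine (mu B).
have := Rintegral_sqr_sum_ge0 mu c (bounded_measurable_visit_avg m 0)
  (bounded_measurable_visit_avg m v).
by rewrite !Rintegral_visit_avg // !Rintegral_visit_avgM !subrr (subr0 v) -/c; lra.
Qed.

(** Let [k] be the positive part of the excess of G_m over (1 + delta) mu(B). As G_m lies in [0, 1],
    its square is at most (1 + delta) mu(B) G_m + k, and the integral of [k] tends to 0 by dominated
    convergence. *)
Lemma equidistributed_energy (delta eps : R) : 0 <= delta -> 0 < eps ->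
  equidistributed mu T q delta B ->
  exists2 m : nat, (0 < m)%N &
    avg_correlation m 0 <= (1 + delta) * fine (mu B) ^+ 2 + eps.
Proof.
move=> delta0 eps0 equi; set c := fine (mu B).
have muBE : mu B = c%:E by rewrite fineK // fin_num_measure.
case: (Tmp) => T0 _.
pose k n x := Num.max (avg n x - (1 + delta) * c) 0.
have c0 : 0 <= c by rewrite fine_ge0.
have Cge0 : 0 <= (1 + delta) * c by rewrite mulr_ge0 // addr_ge0.
have k01 n x : 0 <= k n x <= 1.
  rewrite /k le_max lexx orbT ge_max ler01 andbT.
  by have /andP[_ h] := visit_avg_itv n x; lra.
have mavg n : measurable_fun setT (avg n).
  have [+ _] := bounded_measurable_visit_avg n 0.
  by under eq_fun do rewrite T0.
have bk n : bounded_measurable (k n).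
  split; last by exists 1 => x; rewrite ger0_norm; have /andP[] := k01 n x.
  apply: measurable_maxr; last exact: measurable_cst.
  by apply: measurable_funB => //; exact: measurable_cst.
have := @dominated_convergence _ X R mu setT measurableT
  (fun n x => (k n x)%:E) (cst 0%E) (cst 1%E).
case.
- by move=> n; apply/measurable_EFinP; have [] := bk n.
- exact: measurable_cst.
- move: equi; rewrite /equidistributed; apply: filterS => x [cv lim_le] _.
  apply: cvg_EFin; first by near=> n.
  apply/cvgr0Pnorm_lt => e e0.
  move: lim_le; rewrite muBE -EFinM lee_fin => lim_le.
  have /cvgrPdist_lt/(_ e e0) := cv.
  apply: filterS => n /= close.
  rewrite ger0_norm; last by have /andP[] := k01 n x.
  rewrite /k gt_max e0 andbT; move: close; rewrite ltr_norml => /andP[close _].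
  by move: close lim_le; rewrite /avg; lra.
- exact: (bounded_measurable_integrable mu (bounded_measurable_cst X (1 : R))).
- apply: aeW => x n _ /=; rewrite lee_fin ger0_norm; by have /andP[] := k01 n x.
move=> _ _; rewrite integral0 => /fine_cvgP[_ /cvgr0Pnorm_lt /(_ eps eps0)] near_eps.
have [m [m0 small]] : exists m, (0 < m)%N /\ `|\int[mu]_x k m x| < eps.
  have [m [? ?]] := filter_ex (filterI near_eps (nbhs_infty_gt 0)).
  by exists m.
exists m => //; rewrite -(subrr 0) -Rintegral_visit_avgM.
apply: (@le_trans _ _ (\int[mu]_x ((1 + delta) * c * avg m (T 0 x) + k m x))).
  apply: le_Rintegral => //.
  - apply: bounded_measurable_integrable.
    by apply: bounded_measurableM; exact: bounded_measurable_visit_avg.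
  - apply: bounded_measurable_integrable; apply: bounded_measurableD => //.
    apply: bounded_measurableM; first exact: bounded_measurable_cst.
    exact: bounded_measurable_visit_avg.
  move=> x _; rewrite T0.
  have kx : avg m x - (1 + delta) * c <= k m x by rewrite /k le_max lexx.
  have /andP[a0 a1] := visit_avg_itv m x; have /andP[k0 _] := k01 m x.
  have := ler_wpM2l a0 kx; have := ler_wpM2r k0 a1; lra.
rewrite RintegralD //; first last.
- exact: bounded_measurable_integrable.
- apply: bounded_measurable_integrable; apply: bounded_measurableM.
    exact: bounded_measurable_cst.
  exact: bounded_measurable_visit_avg.
rewrite Rintegral_scale ?Rintegral_visit_avg //; last exact: bounded_measurable_visit_avg.
rewrite expr2 mulrA lerD2l ltW // (le_lt_trans (ler_norm _)) //.
Unshelve. all: by end_near.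
Qed.

End VisitAverage.

(** * Recurrence *)

(** Swapping the pair changes the sign of the sine terms, so they cancel. *)
Lemma sum_cos_difference (R : realType) (I : finType) (t : R) (x : I -> R) :
  \sum_(ab : I * I) cos (2 * (t + (x ab.1 - x ab.2)))
  = cos (2 * t) * \sum_(ab : I * I) cos (2 * (x ab.1 - x ab.2)).
Proof.
have sin0 : \sum_(ab : I * I) sin (2 * (x ab.1 - x ab.2)) = 0.
  set S := \sum_(ab : _) _; suff : S = - S by lra.
  rewrite {1}/S (reindex_inj (h := fun ab : I * I => (ab.2, ab.1))) /=; last first.
    by move=> [a b] [a' b'] /= [-> ->].
  by rewrite -sumrN; apply: eq_bigr => ab _; rewrite -sinN -mulrN opprB.
under eq_bigr do rewrite mulrDr cosD.
by rewrite sumrB -!mulr_sumr sin0 mulr0 subr0.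
Qed.

Definition linear_form_poly (R : realType) (r : nat) (P : polymap r) (theta : 'I_r -> R) :
    {poly R} :=
  \sum_i theta i *: map_poly intr (P i).

Lemma horner_linear_form_poly (R : realType) (r : nat) (P : polymap r)
    (theta : 'I_r -> R) (n : nat) :
  (linear_form_poly P theta).[n%:R] = angle theta (polymap_evalZ P n%:Z).
Proof.
rewrite /linear_form_poly horner_sum; apply: eq_bigr => i _.
have -> : n%:R = (n%:Z)%:~R :> R by [].
by rewrite hornerZ horner_map mxE mulrC.
Qed.

Lemma coef_linear_form_poly (R : realType) (r : nat) (P : polymap r)
    (theta : 'I_r -> R) (j : nat) :
  (linear_form_poly P theta)`_j = \sum_i theta i * ((P i)`_j)%:~R.
Proof.
by rewrite coef_sum; apply: eq_bigr => i _; rewrite coefZ coef_map.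
Qed.

Lemma size_linear_form_poly (R : realType) (r D : nat) (P : polymap r)
    (theta : 'I_r -> R) :
  deg_le D P -> (size (linear_form_poly P theta) <= D.+1)%N.
Proof.
move=> dP; apply: (leq_trans (size_sum _ _ _)); apply/bigmax_leqP => i _.
apply: leq_trans (size_scale_leq _ _) _.
by apply: leq_trans (dP i); rewrite /map_poly size_poly.
Qed.

(** 1 - cos 2x = 2 sin^2 x, and two points of the box differ by [q] times a vector with entries
    below [m] in absolute value. *)
Lemma box_cos_avg_ge (R : realType) (r q m : nat) (theta : 'I_r -> R) (rho : R) :
  (0 < m)%N -> 0 <= rho -> r%:R * (m%:R * rho) <= 1 ->
  (forall i, `|sin (q%:R * theta i)| <= rho) ->
  1 - (m%:R ^+ r * m%:R ^+ r)^-1 *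
    \sum_(ab : {ffun 'I_r -> 'I_m} * {ffun 'I_r -> 'I_m})
      cos (2 * (angle theta (box_vec q ab.1) - angle theta (box_vec q ab.2)))
  <= 2 * (r%:R * (m%:R * rho)).
Proof.
move=> m0 rho0 small1 small.
have M0 : 0 < m%:R ^+ r * m%:R ^+ r :> R by rewrite mulr_gt0 // exprn_gt0 // ltr0n.
have one : 1 = (m%:R ^+ r * m%:R ^+ r)^-1 *
    \sum_(ab : {ffun 'I_r -> 'I_m} * {ffun 'I_r -> 'I_m}) 1 :> R.
  rewrite sumr_const card_prod card_ffun !card_ord natrM natrX mulVf //.
  by rewrite gt_eqF.
rewrite [X in X - _]one -mulrBr -sumrB mulrC ler_pdivrMr //.
have -> : 2 * (r%:R * (m%:R * rho)) * (m%:R ^+ r * m%:R ^+ r) =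
    \sum_(ab : {ffun 'I_r -> 'I_m} * {ffun 'I_r -> 'I_m}) 2 * (r%:R * (m%:R * rho)).
  by rewrite sumr_const card_prod card_ffun !card_ord -(mulr_natl (2 * _)) natrM natrX mulrC.
apply: ler_sum => -[a b] _ /=; rewrite cos_double opprB addrC subrK.
rewrite ler_pM2l // -angleB /angle.
set x := \sum_i _.
have xs : `|sin x| <= r%:R * (m%:R * rho).
  apply: le_trans (normr_sin_sum _ _ _) _.
  rewrite -sumr_const_ord; apply: ler_sum => i _.
  have -> : ((box_vec q a - box_vec q b) 0 i)%:~R * theta i
     = ((a i)%:Z - (b i)%:Z)%:~R * (q%:R * theta i).
    by rewrite !mxE -mulrBr intrM opprD addrACA subrr addr0 mulrCA mulrA.
  apply: le_trans (normr_sinM_int _ _) _; apply: ler_pM => //.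
  have -> : m%:R = (m%:Z)%:~R :> R by [].
  rewrite ler_int; have := ltn_ord (a i); have := ltn_ord (b i); lia.
rewrite -real_normK ?num_real // expr2; apply: le_trans (ler_wpM2l _ xs) _ => //.
by rewrite ler_piMl ?mulr_ge0 //; exact: le_trans xs _.
Qed.

Theorem theorem4p3 (R : realType) (D r Q : nat) (eps : R) :
  (0 < D)%N -> (0 < r)%N -> (0 < Q)%N -> 0 < eps ->
  exists q : nat, (0 < q)%N /\
  forall delta : R, 0 < delta -> delta <= 1 ->
  forall P : polymap r, deg_le D P -> mult_complexity D Q P ->
    hyperplane_fleeing R P ->
  forall (d : measure_display) (X : measurableType d) (mu : probability X R)
         (T : 'rV[int]_r -> X -> X),
    mp_action mu T -> ergodic_action mu T ->
  forall B : set X, measurable B -> equidistributed mu T q delta B ->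
  forall N : int, exists n : int, N < n /\
    (mu (T (polymap_evalZ P n) @` B `&` B) >
       mu B * mu B - (eps + Num.sqrt (3 * delta))%:E)%E.
Proof.
(* Four shares: one for the energy of G_m, two for the constant term of the certificate, one for
   strictness. *)
move=> _ _ _ eps0; pose e := eps / 4.
have e0 : 0 < e by rewrite divr_gt0.
have [k k0 weyl] := uniform_weyl D e0.
exists (k * Q`!)%N; split; first by rewrite muln_gt0 k0 fact_gt0.
set q := (k * Q`!)%N.
move=> delta delta0 delta1 P dP mc fl d X mu T Tmp _ B mB equi N.
have [m m0 energy] := equidistributed_energy Tmp mB (ltW delta0) e0 equi.
set c := fine (mu B) in energy.
have muBE : mu B = c%:E by rewrite fineK // fin_num_measure.
(* Chosen after [m], so that 1 - D_m is at most [e] near the torsion points. *)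
pose rho : R := Num.min 1 (e / 2) / (r%:R * m%:R + 1).
have den0 : 0 < r%:R * m%:R + 1 :> R by rewrite ltr_wpDl.
have rho0 : 0 < rho by rewrite divr_gt0 // lt_min ltr01 divr_gt0.
have rhoE : r%:R * (m%:R * rho) <= Num.min 1 (e / 2).
  rewrite mulrA -[leRHS](divfK (lt0r_neq0 den0)) -/rho [leRHS]mulrC.
  by rewrite ler_wpM2r ?ltW // ltrDl.
have [rho1 rho2] : r%:R * (m%:R * rho) <= 1 /\ 2 * (r%:R * (m%:R * rho)) <= e.
  by move: rhoE; rewrite le_min => /andP[? ?]; split => //; lra.
have [eta eta0 torsion] := near_torsion k dP mc fl rho0.
have [ws [wsP ws1 wsW]] := weyl eta `|N|%N eta0.
pose Pv (w : R * nat) := polymap_evalZ P w.2%:Z.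
pose M : R := (m%:R ^+ r * m%:R ^+ r)^-1.
pose box := enum {: {ffun 'I_r -> 'I_m} * {ffun 'I_r -> 'I_m}}.
(* The coefficients of 2e + W (1 - D_m). *)
pose s : seq (R * 'rV[int]_r) := (2 * e, 0) :: [seq (w.1, Pv w) | w <- ws]
  ++ [seq (- (w.1 * M), Pv w + (box_vec q ab.1 - box_vec q ab.2)) | w <- ws, ab <- box].
have sE (F : 'rV[int]_r -> R) : \sum_(w <- s) w.1 * F w.2 =
    2 * e * F 0 + \sum_(w <- ws) w.1 * (F (Pv w) -
      M * \sum_(ab : {ffun 'I_r -> 'I_m} * {ffun 'I_r -> 'I_m})
            F (Pv w + (box_vec q ab.1 - box_vec q ab.2))).
  rewrite /s big_cons big_cat /= big_map big_allpairs_dep -big_split /=.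
  congr (_ + _); apply: eq_bigr => w _.
  by rewrite -mulr_sumr /box big_enum /=; ring.
have certificate theta : 0 <= \sum_(w <- s) w.1 * cos (2 * angle theta w.2).
  rewrite (sE (fun v => cos (2 * angle theta v))).
  have -> : angle theta 0 = 0.
    by rewrite /angle big1 // => i _; rewrite mxE mul0r.
  rewrite mulr0 cos0 mulr1.
  pose Dm := M * \sum_(ab : {ffun 'I_r -> 'I_m} * {ffun 'I_r -> 'I_m})
      cos (2 * (angle theta (box_vec q ab.1) - angle theta (box_vec q ab.2))).
  pose W := \sum_(w <- ws) w.1 * cos (2 * angle theta (Pv w)).
  have -> : \sum_(w <- ws) w.1 * (cos (2 * angle theta (Pv w)) -
      M * \sum_(ab : {ffun 'I_r -> 'I_m} * {ffun 'I_r -> 'I_m})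
            cos (2 * angle theta (Pv w + (box_vec q ab.1 - box_vec q ab.2))))
      = W * (1 - Dm).
    rewrite /W mulr_suml; apply: eq_bigr => w _.
    under eq_bigr do rewrite angleD angleB.
    by rewrite (sum_cos_difference _ (fun a => angle theta (box_vec q a))) /Dm; ring.
  have W1 : `|W| <= 1.
    apply: le_trans (ler_norm_sum _ _ _) _; rewrite -ws1 big_seq [leRHS]big_seq.
    apply: ler_sum => w /wsP[w0 _]; rewrite normrM ger0_norm // ler_piMr //.
    exact: cos_max.
  have DmE : `|Dm| <= 1.
    have M0 : 0 < m%:R ^+ r * m%:R ^+ r :> R by rewrite mulr_gt0 // exprn_gt0 // ltr0n.
    rewrite /Dm /M normrM normfV (gtr0_norm M0) mulrC ler_pdivrMr // mul1r.
    have -> : m%:R ^+ r * m%:R ^+ r =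
        \sum_(ab : {ffun 'I_r -> 'I_m} * {ffun 'I_r -> 'I_m}) 1 :> R.
      by rewrite sumr_const card_prod card_ffun !card_ord natrM natrX.
    by apply: le_trans (ler_norm_sum _ _ _) (ler_sum _ _) => *; exact: cos_max.
  move: DmE; rewrite ler_norml => /andP[Dm1 Dm2].
  have D0 : 0 <= 1 - Dm by rewrite subr_ge0.
  (* Where |W| >= e, Weyl and torsion give 1 - D_m <= e, while |W| <= 1; elsewhere 1 - D_m <= 2. The
     product is at least -2e either way. *)
  have [large|small] := leP e `|W|.
    have : 1 - Dm <= 2 * (r%:R * (m%:R * rho)).
      apply: box_cos_avg_ge => //; first exact: ltW.
      apply: torsion => j jD; rewrite -coef_linear_form_poly.
      apply: wsW jD; first exact: size_linear_form_poly.
      by under eq_bigr do rewrite horner_linear_form_poly.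
    move=> Dme; have := ler_wpM2r D0 W1; rewrite -(ger0_norm D0) -normrM.
    by rewrite (ger0_norm D0) mul1r ler_norml => /andP[]; lra.
  have := ler_wpM2r D0 (ltW small); rewrite -(ger0_norm D0) -normrM (ger0_norm D0).
  rewrite ler_norml => /andP[lo _].
  have : e * (1 - Dm) <= e * 2 by rewrite ler_pM2l //; lra.
  lra.
have := nonneg_trig_correlation Tmp mB certificate.
rewrite (sE (correlation mu T B)) => pos.
apply: contrapT => /forallNP none.
have corr_le w : w \in ws -> correlation mu T B (Pv w) <= c ^+ 2 - (eps + Num.sqrt (3 * delta)).
  move=> /wsP[_ Nw]; have := none w.2%:Z; apply: contra_notP => /negP.
  rewrite -ltNge => lt; split.
    apply: le_lt_trans (ler_norm _) _; rewrite -abszE ltz_nat //.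
  case: (Tmp) => T0 [TD _].
  have -> : T (polymap_evalZ P w.2%:Z) @` B `&` B = B `&` T (- Pv w) @^-1` B.
    apply/seteqP; split => x /=.
      by move=> [[y By <-] Bx]; split => //; rewrite -TD addNr T0.
    move=> [Bx By]; split => //; exists (T (- Pv w) x) => //.
    by rewrite -TD subrr T0.
  have mA : measurable (B `&` T (- Pv w) @^-1` B).
    by apply: measurableI => //; exact: (measurable_action_preimage Tmp).
  rewrite muBE -EFinM -EFinB -[ltRHS]fineK ?fin_num_measure //.
  by rewrite lte_fin -/(correlation mu T B (- Pv w)) correlationN // -expr2.
(* Since delta <= 1, delta^2 <= 3 delta. *)
have delta_sqrt : delta * c ^+ 2 <= Num.sqrt (3 * delta).
  have c01 : 0 <= c <= 1.
    by rewrite fine_ge0 //= -lee_fin -muBE probability_le1.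
  have /andP[c0 c1] := c01.
  apply: (@le_trans _ _ delta).
    by apply: ler_piMr; [exact: ltW | exact: exprn_ile1].
  rewrite -[leLHS](ger0_norm (ltW delta0)) -sqrtr_sqr ler_wsqrtr // expr2.
  by apply: ler_wpM2r; [exact: ltW | lra].
have : \sum_(w <- ws) w.1 * (correlation mu T B (Pv w) - avg_correlation mu T B q m (Pv w))
    <= \sum_(w <- ws) w.1 * (- (3 * e)).
  rewrite big_seq [leRHS]big_seq; apply: ler_sum => w win.
  have [w0 _] := wsP _ win; apply: ler_wpM2l => //.
  have := avg_correlation_ge Tmp mB q (Pv w) m0; have := corr_le _ win.
  rewrite -/c; move: energy delta_sqrt; rewrite /e; lra.
rewrite -mulr_suml ws1 mul1r => upper.
have := correlation_itv Tmp mB 0.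
move: pos upper; rewrite /avg_correlation -/M => pos upper /andP[_ c1].
have e20 : 0 <= 2 * e by rewrite mulr_ge0 // ltW.
by have := ler_wpM2l e20 c1; move: pos upper; lra.
Qed.
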